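(* Every desirable group is isomorphic to one of the following: (1) an abelian group whose exponent divides $4$ or $6$; (2) $Q_8\times C_2^m$ for some nonnegative integer $m$; (3) $S_3$; (4) $S_3\times C_2$; (5) $C_3\rtimes C_4=\langle x,y\mid x^3=y^4=1,\ y^{-1}xy=x^{-1}\rangle$.
   Context: All groups are finite. $C_n$, $S_n$, $Q_8$ denote the cyclic group of order $n$, the symmetric group of degree $n$, and the quaternion group of order $8$. An association scheme (scheme) is a pair $(X,S)$ with $X$ a finite set and $S$ a partition of $X\times X$ such that: $1_X=\{(x,x)\mid x\in X\}\in S$; for $s\in S$, $s^*=\{(y,x)\mid (x,y)\in s\}\in S$; and for all $s,t,u\in S$ the size of $\{z\in X\mid (x,z)\in s,\ (z,y)\in t\}$ is a constant $a_{stu}$ for all $(x,y)\in u$. The adjacency matrix $\sigma_s$ of $s\in S$ is the $0$-$1$ matrix indexed by $X\times X$ with $(\sigma_s)_{x,y}=1$ iff $(x,y)\in s$. The scheme is symmetric if every $\sigma_s$ is a symmetric matrix, and integral if all eigenvalues of all $\sigma_s$, $s\in S$, are integers. A fusion scheme of $(X,S)$ is a scheme $(X,T)$ such that each element of $T$ is a union of elements of $S$. The scheme $(X,S)$ is desirable if every symmetric fusion scheme of $(X,S)$ is integral. For a finite group $G$, let $\tilde g=\{(a,b)\in G\times G\mid ag=b\}$ for $g\in G$ and $\tilde G=\{\tilde g\mid g\in G\}$; then $(G,\tilde G)$ is a scheme. A finite group $G$ is called desirable if $(G,\tilde G)$ is desirable, and undesirable otherwise. *)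

(* Defs.v *)
From mathcomp Require Import all_boot all_order all_algebra.
From mathcomp Require Import all_fingroup all_solvable all_field.

Set Implicit Arguments.
Unset Strict Implicit.
Unset Printing Implicit Defensive.

Import Order.TTheory GRing.Theory Num.Theory.

Section Schemes.

Variable X : finType.
Implicit Types (s t u : {set X * X}) (S T : {set {set X * X}}).

Definition diag_rel : {set X * X} := [set p | p.1 == p.2].

Definition transpose_rel s : {set X * X} := [set p | (p.2, p.1) \in s].

Definition is_scheme S : Prop :=
  [/\ partition S [set: X * X],
      diag_rel \in S,
      forall s, s \in S -> transpose_rel s \in S
    & forall s t u, s \in S -> t \in S -> u \in S ->
        exists a : nat, forall x y, (x, y) \in u ->
          #|[set z | ((x, z) \in s) && ((z, y) \in t)]| = a].

(* Rows and columns are indexed by X through enum_val.  The entries are taken *)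
(* in the algebraic complex numbers, which contain every complex eigenvalue   *)
(* of a 0-1 matrix.                                                           *)
Definition adjacency_mx s : 'M[algC]_#|X| :=
  \matrix_(i, j) ((enum_val i, enum_val j) \in s)%:R%R.

Definition symmetric_scheme S : Prop :=
  forall s, s \in S -> ((adjacency_mx s)^T)%R = adjacency_mx s.

Definition integral_scheme S : Prop :=
  forall s, s \in S -> forall a : algC,
    eigenvalue (adjacency_mx s) a -> a \is a Num.int.

Definition fusion_scheme S T : Prop :=
  is_scheme T /\
  forall t, t \in T -> exists2 U : {set {set X * X}}, U \subset S & t = cover U.

Definition desirable_scheme S : Prop :=
  forall T, fusion_scheme S T -> symmetric_scheme T -> integral_scheme T.

End Schemes.

Section GroupScheme.

Local Open Scope group_scope.

Variable gT : finGroupType.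

Definition translation_rel (g : gT) : {set gT * gT} :=
  [set p | p.1 * g == p.2].

Definition group_scheme : {set {set gT * gT}} :=
  [set translation_rel g | g : gT].

Lemma group_scheme_is_scheme : is_scheme group_scheme.
Proof.
have mem_tr g x y : ((x, y) \in translation_rel g) = (x * g == y) by rewrite inE.
split.
- apply/and3P; split.
  + apply/eqP/setP=> -[x y]; rewrite inE; apply/bigcupP.
    exists (translation_rel (x^-1 * y)); first exact: imset_f.
    by rewrite mem_tr mulKVg.
  + apply/trivIsetP=> _ _ /imsetP[g _ ->] /imsetP[h _ ->]; apply: contraR.
    case/pred0Pn=> -[x y] /andP[/=]; rewrite !mem_tr => /eqP <- /eqP.
    by move/mulgI=> ->.
  + apply/imsetP=> -[g _] /setP/(_ (1, g)).
    by rewrite inE mem_tr mul1g eqxx.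
- apply/imsetP; exists 1 => //.
  by apply/setP=> -[x y]; rewrite mem_tr inE mulg1.
- move=> _ /imsetP[g _ ->]; apply/imsetP; exists g^-1 => //.
  apply/setP=> -[x y]; rewrite mem_tr inE mem_tr /=.
  by apply/eqP/eqP=> <-; rewrite ?mulgK ?mulgKV.
- move=> _ _ _ /imsetP[g _ ->] /imsetP[h _ ->] /imsetP[k _ ->].
  exists (g * h == k) => x y; rewrite mem_tr => /eqP <-.
  have -> : [set z | ((x, z) \in translation_rel g) &&
                     ((z, x * k) \in translation_rel h)]
          = [set z in pred1 (x * g) | g * h == k].
    apply/setP=> z; rewrite !inE /= eq_sym; case: eqP => //= ->.
    by rewrite -mulgA (inj_eq (mulgI x)).
  case: (g * h == k) => /=.
  + have -> : [set z in pred1 (x * g) | true] = [set x * g].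
      by apply/setP=> z; rewrite !inE andbT.
    exact: cards1.
  + by apply/eqP; rewrite cards_eq0; apply/eqP/setP=> z; rewrite !inE andbF.
Qed.

Definition desirable_group : Prop := desirable_scheme group_scheme.

End GroupScheme.

(* Main.v *)
Require Import Defs.
From mathcomp Require Import all_boot all_order all_algebra.
From mathcomp Require Import all_fingroup all_solvable all_field all_character.
From mathcomp Require Import ring.

(** Fusion schemes of the group scheme of G correspond to Schur rings over G:
partitions of G such that the functions constant on the blocks are closed under
convolution.  A symmetric one has all its blocks closed under inversion, and
the eigenvalues of its adjacency matrices are those of the convolutions by the
indicators of the blocks.

The property of having a symmetric Schur ring with an irrational eigenvalue
passes from a section Q of G, that is, from a quotient of a subgroup H, up to G
([irrational_section]): pull the blocks back to H, separate 1 from the rest of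
the kernel, and let the complement of H be one more block (a wreath product).
So no section of a desirable group is such a group.  The bad sections used are:

- the cyclic groups of order n with phi(n) > 2, where the blocks {x, x^-1} give
  the eigenvalue 2 cos(2 pi / n) of degree phi(n) / 2 ([irrational_cycle]);
- the dihedral groups of order 8 and 12, acting regularly on the octagon and on
  the dodecagon, with eigenvalues sqrt 2 and sqrt 3;
- C3 x S3 and C3^2 : C2 (inversion), acting regularly on the Pappus graph, with
  eigenvalue sqrt 3;
- the alternating group of degree 4, acting regularly on the icosahedron, with
  eigenvalue sqrt 5;
- the Heisenberg group of order 27, where the orbits of a dihedral group of
  automorphisms of order 8 give the eigenvalue 1 + sqrt 3.

All but the first family are semidirect products of a group with at most two
generators by a cyclic group, and their Schur rings are verified by computation
on a multiplication table.

The rest is group theory.  Element orders are 1, 2, 3, 4 or 6.  In a 2-subgroup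
the octagon makes involutions central, and then two elements that do not
commute satisfy x^2 = y^2 = [x, y]; this gives Q8 x C2^m ([two_group_isog]).
The Heisenberg group makes 3-subgroups elementary abelian, and the alternating
group forces elements of order 3 to centralise the 2-subgroups that they
normalise, so that the Sylow 3-subgroup P is normal, with a complement Q
([integral_sdprod]).  If Q does not centralise P, the two Pappus groups leave
only |P| = 3, and the dodecagon makes Q cyclic, generated by an element that
inverts P ([inverted_sylow3]). *)

Set Implicit Arguments.
Unset Strict Implicit.
Unset Printing Implicit Defensive.

Import GRing.Theory Num.Theory.
Local Open Scope group_scope.

(** * Schur rings and fusion schemes *)

Section SchurRings.

Variable rT : finGroupType.
Implicit Types (B : {group rT}) (F : rT -> algC).

Definition convolution B F1 F2 (x : rT) : algC :=
  (\sum_(z in B) F1 z * F2 (z^-1 * x)%g)%R.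

Definition class_function (K : eqType) B (c : rT -> K) F :=
  {in B &, forall x y, c x = c y -> F x = F y}.

(** The closure condition is stated with functions rather than with
structure constants because it is then bilinear: [convolution_spread] below
checks it on a decomposition of functions instead of block by block. *)
Definition schur_coloring (K : eqType) B (c : rT -> K) :=
  [/\ {in B, forall x, c x = c 1 -> x = 1},
      {in B, forall x, c x^-1 = c x}
    & forall F1 F2, class_function B c F1 -> class_function B c F2 ->
        class_function B c (convolution B F1 F2)].

(** The eigenvalue is required to be an algebraic integer so that its
nonzero integer multiples, which occur when a Schur ring is pulled back along a
morphism with a kernel, are not integers either. *)
Definition irrational_sring B := exists (K : eqType) (c : rT -> K),
  schur_coloring B c /\
  exists (k : K) (a : algC) (phi : rT -> algC),
  [/\ a \in Aint, a \isn't a Num.int,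
      exists2 x, x \in B & phi x != 0%R
    & {in B, forall x, (\sum_(s in B | c s == k) phi (x * s)%g = a * phi x)%R}].

End SchurRings.

Section FromScheme.

Variables (gT : finGroupType) (K : eqType) (c : gT -> K).

Definition color_rel (g : gT) : {set gT * gT} :=
  [set p | c (p.1^-1 * p.2) == c g].

Definition color_scheme : {set {set gT * gT}} := [set color_rel g | g : gT].

Hypothesis sring : schur_coloring [set: gT] c.

(** Convolving the indicators of two blocks counts the paths that define
the structure constants. *)
Lemma color_scheme_is_scheme : is_scheme color_scheme.
Proof.
case: sring => c1 cV cM.
have mem_cr g x y : ((x, y) \in color_rel g) = (c (x^-1 * y) == c g).
  by rewrite inE.
split.
- apply/and3P; split.
  + apply/eqP/setP=> -[x y]; rewrite inE; apply/bigcupP.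
    by exists (color_rel (x^-1 * y)); [apply: imset_f | rewrite mem_cr].
  + apply/trivIsetP=> _ _ /imsetP[g _ ->] /imsetP[h _ ->]; apply: contraR.
    case/pred0Pn=> -[x y] /andP[/=]; rewrite !mem_cr => /eqP eg /eqP eh.
    by apply/eqP/setP=> p; rewrite !inE -eg eh.
  + apply/imsetP=> -[g _] /setP/(_ (1, g)).
    by rewrite mem_cr invg1 mul1g inE eqxx.
- apply/imsetP; exists 1 => //; apply/setP=> -[x y]; rewrite mem_cr inE /=.
  apply/eqP/eqP=> [->|e]; first by rewrite mulVg.
  have e1 : x^-1 * y = 1 by apply: c1; rewrite ?inE.
  by rewrite -[y](mulKVg x) e1 mulg1.
- move=> _ /imsetP[g _ ->]; apply/imsetP; exists g => //.
  apply/setP=> -[x y]; rewrite mem_cr inE mem_cr /=.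
  by rewrite -[y^-1 * x]invgK cV ?inE // invMg invgK.
- move=> _ _ _ /imsetP[g _ ->] /imsetP[h _ ->] /imsetP[k _ ->].
  pose ind u (x : gT) : algC := ((c x == c u)%:R)%R.
  have ind_class u : class_function [set: gT] c (ind u).
    by move=> x y _ _; rewrite /ind => ->.
  have count x y : (#|[set z | ((x, z) \in color_rel g) &&
        ((z, y) \in color_rel h)]|%:R)%R
      = convolution [set: gT] (ind g) (ind h) (x^-1 * y).
    rewrite /convolution (reindex_inj (mulgI x^-1)) /= -sum1_card natr_sum.
    rewrite (eq_bigl (fun z => ((x, z) \in color_rel g) && ((z, y) \in color_rel h)));
      last by move=> z; rewrite inE.
    rewrite big_mkcond /=; apply: eq_big => z; first by rewrite !inE.
    rewrite !mem_cr /ind invMg invgK mulgA mulgK => _.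
    by do 2!case: eqP; rewrite ?mulr1 ?mulr0 ?mul0r.
  exists #|[set z | ((1, z) \in color_rel g) && ((z, k) \in color_rel h)]|.
  move=> x y; rewrite mem_cr => /eqP exy.
  apply/eqP; rewrite -(eqr_nat algC) !count; apply/eqP.
  by apply: (cM) => //; rewrite ?inE // invg1 mul1g.
Qed.

Lemma color_scheme_fusion : fusion_scheme (group_scheme gT) color_scheme.
Proof.
split; first exact: color_scheme_is_scheme.
move=> _ /imsetP[g _ ->].
exists [set translation_rel h | h in [pred h | c h == c g]].
  by apply/subsetP=> _ /imsetP[h _ ->]; apply: imset_f.
apply/setP=> -[x y]; rewrite inE /=; apply/idP/bigcupP=> [cxy|].
  exists (translation_rel (x^-1 * y)); last by rewrite inE mulKVg.
  by apply: imset_f; rewrite inE.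
by case=> _ /imsetP[h ch ->]; rewrite inE => /= /eqP <-; rewrite mulKg.
Qed.

Lemma color_scheme_sym : symmetric_scheme color_scheme.
Proof.
case: sring => _ cV _ _ /imsetP[g _ ->]; apply/matrixP=> i j.
rewrite !mxE !inE /=; set x := enum_val i; set y := enum_val j.
by rewrite -[y^-1 * x]invgK cV ?inE // invMg invgK.
Qed.

End FromScheme.

(** The adjacency matrix of a block is symmetric, so the row vector of
the values of an eigenfunction of the convolution is a left eigenvector. *)
Lemma desirable_no_irrational gT :
  desirable_group gT -> ~ irrational_sring [set: gT].
Proof.
move=> hG [K [c [sr [k [a [phi [_ aNint [x0 _ phix0] eig]]]]]]].
(* A color that does not occur has the eigenvalue 0. *)
have [g cg | no_k] := pickP (fun g => c g == k); last first.
  case/negP: aNint; move/(_ x0 (in_setT _))/eqP: eig.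
  rewrite big_pred0 => [|s]; last by rewrite no_k andbF.
  by rewrite eq_sym mulf_eq0 (negPf phix0) orbF => /eqP->; apply: rpred0.
case/negP: aNint.
apply: (hG _ (color_scheme_fusion sr) (color_scheme_sym sr) (color_rel c g)).
  exact: imset_f.
apply/eigenvalueP; exists (\row_i phi (enum_val i))%R; last first.
  apply/eqP=> /rowP/(_ (enum_rank x0)); rewrite !mxE enum_rankK => /eqP.
  exact/negP.
apply/rowP=> j; rewrite !mxE -eig ?inE //; set y := enum_val j.
rewrite (reindex (@enum_rank gT)) /=; last first.
  by exists enum_val => ? _; rewrite ?enum_valK ?enum_rankK.
have [_ cV _] := sr.
rewrite (reindex_inj (mulgI y)) /= [RHS]big_mkcond /=.
apply: eq_bigr => s _; rewrite !mxE enum_rankK !inE /= -/y.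
rewrite invMg -mulgA mulVg mulg1 cV ?inE // (eqP cg).
by case: eqP; rewrite ?mulr1 ?mulr0.
Qed.

(** * Schur rings of a section *)

Section Transfer.

Variables (gT rT : finGroupType) (H : {group gT}) (f : {morphism H >-> rT}).
Let B := f @* H.
Let e : algC := #|'ker f|%:R%R.

(** Every fibre of a morphism is a coset of its kernel. *)
Lemma sum_morphism (g : rT -> algC) (P : pred rT) :
  (\sum_(z in H | P (f z)) g (f z) = e * \sum_(q in B | P q) g q)%R.
Proof.
rewrite (partition_big f (fun q => (q \in B) && P q)) /=; last first.
  by move=> z /andP[Hz ->]; rewrite mem_morphim.
rewrite big_distrr /=; apply: eq_bigr => _ /andP[/morphimP[w Hw _ ->] Pw].
rewrite (eq_bigr (fun _ => g (f w))) => [|z /andP[_ /eqP->]] //.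
rewrite sumr_const -mulr_natl; congr (_%:R * _)%R.
rewrite -(card_rcoset ('ker f) w); apply: eq_card => z; rewrite unfold_in.
have [Hz /= | nHz /=] := boolP (z \in H); last first.
  apply/esym/(contraNF _ nHz) => /rcosetP[k kk ->].
  by rewrite groupM // (dom_ker kk).
by apply/andP/rcoset_kerP=> // [[_ /eqP //] | ->].
Qed.

Definition lift (F : rT -> algC) (x : gT) : algC :=
  (if x \in H then F (f x) else 0)%R.

Lemma convolution_lift F1 F2 x :
  convolution [set: gT] (lift F1) (lift F2) x
    = lift (fun q => e * convolution B F1 F2 q)%R x.
Proof.
rewrite /convolution /lift.
rewrite (bigID [in H]) /= addrC big1 => [|z /andP[_ /negPf->]]; last by rewrite mul0r.
rewrite add0r; case: ifPn => Hx; last first.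
  apply: big1 => z /andP[_ Hz].
  by rewrite groupMl ?groupV // (negPf Hx) mulr0.
pose g q := (F1 q * F2 (q^-1 * f x)%g)%R.
transitivity (\sum_(z in H) g (f z))%R.
  apply: eq_big => z; first by rewrite inE.
  by case/andP=> _ Hz; rewrite Hz groupM ?groupV // /g morphM ?groupV // morphV.
have E (T : finType) (A : {set T}) (F : T -> algC) :
  (\sum_(z in A | true) F z = \sum_(z in A) F z)%R.
  by apply: eq_bigl => z; rewrite andbT.
by have := sum_morphism g xpredT; rewrite !E.
Qed.

Variables (K : eqType) (c : rT -> K).
Hypothesis sring : schur_coloring B c.

(** The wreath product: the complement of [H] is one block, the identity
is another, and the remaining part of [H] is split according to the image
under [f]. *)
Definition section_color (x : gT) : option (option K) :=
  if x \in H then Some (if x == 1 then None else Some (c (f x))) else None.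

(** The general form of a function that is constant on the blocks of
[section_color]; see [spread_class] and [class_spread]. *)
Definition spread F a b (x : gT) : algC :=
  (lift F x + a * (x == 1%g)%:R + b)%R.

Lemma spread_class F a b :
  class_function B c F -> class_function [set: gT] section_color (spread F a b).
Proof.
move=> cF x y _ _; rewrite /section_color /spread /lift.
have neq1 z : (z \in H) = false -> (z == 1) = false.
  by apply: contraFF => /eqP->.
case Hx: (x \in H); case Hy: (y \in H) => //; last by rewrite !neq1.
have [->|_] := eqVneq x 1; have [->|_] := eqVneq y 1 => //.
by case=> cxy; rewrite (cF _ _ _ _ cxy) ?mem_morphim.
Qed.

Lemma class_spread F : class_function [set: gT] section_color F ->
  exists F' a b, class_function B c F' /\ F =1 spread F' a b.
Proof.
have [c1 _ _] := sring => cF.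
(* The default 0 is used only if H is the whole group. *)
pose b := (if [pick x | x \notin H] is Some x then F x else 0)%R.
(* Without the condition x != 1 the value at q = 1 would be read off at the
   identity, which is a block of its own. *)
pose F' q := (if [pick x in H | (x != 1%g) && (f x == q)] is Some x
              then F x - b else 0)%R.
exists F', (F 1%g - b - F' 1%g)%R, b; split=> [q r Bq Br cqr | x].
  have [q1 | ntq] := eqVneq q 1.
    by congr F'; rewrite q1; apply/esym/c1 => //; rewrite -cqr q1.
  have ntr : r != 1 by apply: contraNneq ntq => r1; apply/eqP/c1; rewrite // cqr r1.
  have pickE s : s \in B -> s != 1 ->
      exists2 x, x \in H & [/\ x != 1, f x = s & F' s = (F x - b)%R].
    move=> /morphimP[w Hw _ ->] nt; rewrite /F'; case: pickP => [x|].
      by case/and3P=> Hx ntx /eqP fx; exists x.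
    move/(_ w); rewrite Hw eqxx andbT /=; case: eqP => // w1.
    by rewrite w1 morph1 eqxx in nt.
  have [x Hx [ntx fx ->]] := pickE q Bq ntq.
  have [y Hy [nty fy ->]] := pickE r Br ntr.
  congr (_ - _)%R; apply: cF; rewrite ?inE // /section_color Hx Hy.
  by rewrite (negPf ntx) (negPf nty) fx fy cqr.
rewrite /spread /lift; case: ifPn => Hx.
  have [-> | ntx] := eqVneq x 1%g.
    by rewrite morph1 mulr1 [(F' _ + _)%R]addrC !subrK.
  rewrite mulr0 addr0 /F'; case: pickP => [y /and3P[Hy nty /eqP fy] | /(_ x)].
    rewrite subrK; apply: cF; rewrite ?inE // /section_color Hx Hy.
    by rewrite (negPf ntx) (negPf nty) fy.
  by rewrite Hx ntx eqxx.
have -> : (x == 1) = false by apply: contraNF Hx => /eqP->.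
rewrite mulr0 addr0 add0r /b; case: pickP => [y nHy | /(_ x)]; last by rewrite Hx.
by apply: cF; rewrite ?inE // /section_color (negPf Hx) (negPf nHy).
Qed.

(** The unit mass at 1 is neutral for convolution, and a constant function
convolved with anything is constant; only the product of the two lifted parts
is a genuine convolution, and [convolution_lift] computes it. *)
Lemma convolution_spread F1 a1 b1 F2 a2 b2 :
  convolution [set: gT] (spread F1 a1 b1) (spread F2 a2 b2)
    =1 spread (fun q => e * convolution B F1 F2 q + a2 * F1 q + a1 * F2 q)%R
        (a1 * a2)%R
        (\sum_z lift F1 z * b2 + a1 * b2 + b1 * \sum_z spread F2 a2 b2 z)%R.
Proof.
move=> x.
have convT G1 G2 :
    (convolution [set: gT] G1 G2 x = \sum_z G1 z * G2 (z^-1 * x)%g)%R.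
  by apply: eq_bigl => z; rewrite inE.
rewrite convT.
under eq_bigr do rewrite {1}/spread !mulrDl.
rewrite !big_split /=.
have -> : (\sum_z b1 * spread F2 a2 b2 (z^-1 * x)%g = b1 * \sum_z spread F2 a2 b2 z)%R.
  rewrite -big_distrr /=; congr (_ * _)%R.
  by rewrite [RHS](reindex_inj (mulIg x)) [RHS](reindex_inj invg_inj).
have -> : (\sum_z a1 * (z == 1%g)%:R * spread F2 a2 b2 (z^-1 * x)%g
            = a1 * spread F2 a2 b2 x)%R.
  rewrite (bigD1 1%g) //= eqxx mulr1 invg1 mul1g big1 ?addr0 // => z /negPf->.
  by rewrite mulr0 mul0r.
under eq_bigr do rewrite {1}/spread !mulrDr.
rewrite !big_split /=.
have -> : (\sum_z lift F1 z * (a2 * ((z^-1 * x)%g == 1%g)%:R) = a2 * lift F1 x)%R.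
  rewrite (bigD1 x) //= mulVg eqxx mulr1 mulrC big1 ?addr0 // => z nzx.
  by rewrite -eq_mulVg1 (negPf nzx) !mulr0.
rewrite -convT convolution_lift /spread.
move: (b1 * _)%R (\sum_i lift F1 i * b2)%R => S T.
by rewrite /lift; case: ifP => _; ring.
Qed.

Lemma schur_section : schur_coloring [set: gT] section_color.
Proof.
have [c1 cV cM] := sring.
split=> [x _ | x _ | F1 F2].
- by rewrite /section_color group1 eqxx; case: ifP => // _; case: eqP.
- rewrite /section_color groupV; case: ifP => // Hx.
  by rewrite -eq_invg1 invgK morphV // cV // mem_morphim.
move=> /class_spread[F1' [a1 [b1 [cF1 eF1]]]] /class_spread[F2' [a2 [b2 [cF2 eF2]]]].
move=> x y Gx Gy cxy; set L := convolution _ _ _.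
have eL : L =1 convolution [set: gT] (spread F1' a1 b1) (spread F2' a2 b2).
  by move=> z; apply: eq_bigr => w _; rewrite eF1 eF2.
rewrite !eL !convolution_spread; apply: spread_class => // q r Bq Br cqr /=.
by rewrite (cM _ _ cF1 cF2 _ _ Bq Br cqr) (cF1 _ _ Bq Br cqr) (cF2 _ _ Bq Br cqr).
Qed.

End Transfer.

(** The lift of an eigenfunction is an eigenfunction, and its eigenvalue is
multiplied by the order of the kernel. *)
Lemma irrational_section (gT rT : finGroupType) (H : {group gT})
    (f : {morphism H >-> rT}) :
  irrational_sring (f @* H) -> irrational_sring [set: gT].
Proof.
case=> K [c [sr [k [a [phi [Aa nZa [q0 Bq0 phiq0] eig]]]]]].
exists (option (option K)), (section_color f c); split; first exact: schur_section.
set e : algC := (#|'ker f|%:R)%R.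
have e0 : e != 0%R by rewrite pnatr_eq0 -lt0n cardG_gt0.
exists (Some (Some k)), (e * a)%R, (lift f phi); split.
- by rewrite rpredM ?rpred_nat.
- apply: contra nZa => Zea; apply: Cint_rat_Aint => //.
  rewrite -[a](mulKf e0) rpredM ?rpredV ?rpred_nat //; exact: rpred_int_num.
- case/morphimP: Bq0 phiq0 => x Hx _ -> nz; exists x; rewrite ?inE //.
  by rewrite /lift Hx.
move=> x _; rewrite {2}/lift.
have [c1 _ _] := sr.
(* The block of 1 has the eigenvalue 1, so k is not its color, and removing 1
   from the block of the kernel changes nothing. *)
have [k1 | nk1] := eqVneq k (c 1).
  case/negP: nZa; have := eig _ Bq0.
  rewrite (big_pred1 1%g) => [|s]; last first.
    rewrite k1; apply/andP/eqP=> [[Bs /eqP]|->]; first exact: c1.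
    by rewrite group1.
  rewrite mulg1 -{1}[phi q0]mul1r => /(mulIf phiq0) <-; exact: rpred1.
transitivity (\sum_(s in H | c (f s) == k) lift f phi (x * s)%g)%R.
  apply: eq_bigl => s; rewrite inE /section_color /=.
  case: ifP => // Hs; rewrite /=; have [->|_] := eqVneq s 1; last by [].
  by rewrite morph1 [RHS]eq_sym (negPf nk1).
case: ifP => Hx; last first.
  by rewrite mulr0 big1 // => s /andP[Hs _]; rewrite /lift groupMr ?Hx.
rewrite -mulrA -eig ?mem_morphim // -(sum_morphism f (fun s => phi (f x * s)%g)).
apply: eq_bigr => s /andP[Hs _].
by rewrite /lift groupM // morphM.
Qed.

(** * Schur rings on a multiplication table *)

Lemma sqrtC_not_int (p : int) (d : nat) :
  all (fun i => i * i != d)%N (iota 0 d.+1) ->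
  (p%:~R + sqrtC d%:R : algC)%R \isn't a Num.int.
Proof.
move=> /allP nsq; apply/negP=> Zpd.
have /intrP[z zE] : (sqrtC d%:R : algC)%R \is a Num.int.
  by rewrite -[sqrtC _](addKr p%:~R)%R rpredD // rpredN rpred_int_num.
have /eqP : (d%:R = (z ^+ 2)%:~R :> algC)%R by rewrite rmorphXn /= -zE sqrtCK.
rewrite -[d%:R%R]/((Posz d)%:~R)%R eqr_int => /eqP dz.
have dn : d = (`|z| * `|z|)%N.
  by have /(congr1 absz) := dz; rewrite expr2 abszM absz_nat.
have le_zd : `|z|%N \in iota 0 d.+1.
  by rewrite mem_iota add0n ltnS dn; case: `|z|%N => // n; rewrite leq_pmulr.
by have := nsq _ le_zd; rewrite -dn eqxx.
Qed.

(** A group is given here by a list [L] of codes, with unit [o], product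
[m] and coloring [c], so that all conditions on its Schur ring are decided by
evaluation. *)
Section Table.

Variables (U : eqType) (L : seq U) (o : U) (m : U -> U -> U) (c : U -> nat).

Definition table_inv x := nth o L (find (fun y => m x y == o) L).

Definition table_rep x := nth o L (find (fun y => c y == c x) L).

(** The multiset of pairs of colors of the factorisations of [x].  The
convolution of two class functions at [x] is a sum over this multiset, so a
coloring is a Schur ring as soon as the multiset depends on the color of [x]
only. *)
Definition table_pairs x := [seq (c z, c (m (table_inv z) x)) | z <- L].

Definition table_group : bool :=
  [&& uniq L, o \in L, all (fun x => all (fun y => m x y \in L) L) L,
      all (fun x => (table_inv x \in L) && (m x (table_inv x) == o)) L
    & all (fun x => all (fun y => (m x (table_inv y) == o) ==> (x == y)) L) L].

Definition table_sring : bool :=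
  [&& all (fun x => (c x == c o) ==> (x == o)) L,
      all (fun x => c (table_inv x) == c x) L
    & all (fun x => perm_eq (table_pairs x) (table_pairs (table_rep x))) L].

Definition table_apply k (w : seq int) x : int :=
  foldr +%R 0%R [seq (w`_(c (m x s)))%R | s <- L & c s == k].

(** The function with value [v] + sqrt(d) [w] is an eigenfunction for the
block [k] with eigenvalue p + sqrt(d); comparing the coefficients of 1 and
of sqrt(d) leaves two identities between integers.  The last condition exhibits a point
where the function does not vanish. *)
Definition table_eigen k (p : int) (d : nat) (v w : seq int) : bool :=
  all (fun x => (table_apply k v x == p * v`_(c x) + d%:Z * w`_(c x))%R &&
                (table_apply k w x == v`_(c x) + p * w`_(c x))%R) L
  && has (fun x => (v`_(c x) != 0)%R && (w`_(c x) == 0)%R) L.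

Variables (rT : finGroupType) (e : U -> rT).

(** The map [e] realises the table as a subgroup of [rT].  Only the kernel
of [e] has to be controlled: injectivity follows by multiplying by inverses. *)
Lemma irrational_table k p d v w :
    table_group -> table_sring -> table_eigen k p d v w ->
    all (fun i => i * i != d)%N (iota 0 d.+1) ->
    {in L &, {morph e : x y / m x y >-> x * y}} ->
    {in L, forall x, e x = 1 -> x = o} ->
  irrational_sring <<[set x in map e L]>>.
Proof.
case/and5P=> uL Lo /allP Lm /allP Lv /allP inj_m.
case/and3P=> /allP c1 /allP cV /allP cM /andP[/allP eig nz] nsq eM e1.
have {}Lm : {in L &, forall x y, m x y \in L} by move=> x y /Lm/allP; apply.
have {Lv}[Lv vK] : {in L, forall x, table_inv x \in L} /\
                   {in L, forall x, m x (table_inv x) = o}.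
  by split=> x /Lv/andP[? /eqP].
have eo : e o = 1.
  have ev : e (table_inv o) = 1.
    by apply: (mulgI (e o)); rewrite -eM ?Lv // vK // mulg1.
  by rewrite -ev (e1 _ (Lv _ Lo) ev).
have eV : {in L, forall x, e (table_inv x) = (e x)^-1}.
  by move=> x Lx; apply: (mulgI (e x)); rewrite -eM ?Lv // vK // mulgV.
have inj_e : {in L &, injective e}.
  move=> x y Lx Ly exy; have := inj_m x Lx; move/allP/(_ y Ly)/implyP=> inj.
  apply/eqP/inj/eqP/e1; first by rewrite Lm ?Lv.
  by rewrite eM ?Lv // eV // exy mulgV.
have gB : group_set [set x in map e L].
  apply/group_setP; split=> [|g h].
    by rewrite inE -eo map_f.
  rewrite !inE => /mapP[x Lx ->] /mapP[y Ly ->].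
  by rewrite -eM // map_f // Lm.
set B := <<_>>%G.
have mem_B x : (x \in B) = (x \in map e L).
  by rewrite /= (gen_set_id gB) inE.
clearbody B => {gB}.
have eB x : x \in L -> e x \in B by move=> Lx; rewrite mem_B map_f.
have bP (P : rT -> Prop) : {in L, forall x, P (e x)} -> {in B, forall g, P g}.
  by move=> PL g; rewrite mem_B => /mapP[x Lx ->]; apply: PL.
have sumB (P : pred rT) (F : rT -> algC) :
    (\sum_(g in B | P g) F g = \sum_(x <- L | P (e x)) F (e x))%R.
  rewrite -(big_map e P F) -big_filter -[LHS]big_filter.
  apply: perm_big; apply: uniq_perm; rewrite ?filter_uniq ?index_enum_uniq //.
    by rewrite map_inj_in_uniq.
  by move=> g; rewrite !mem_filter mem_index_enum mem_B andbT andbC.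
pose c' g := c (nth o L (index g (map e L))).
have c'E : {in L, forall x, c' (e x) = c x}.
  by move=> x Lx; rewrite /c' nth_index_map.
have repP x : x \in L -> table_rep x \in L /\ c (table_rep x) = c x.
  move=> Lx; have hx : has (fun y => c y == c x) L by apply/hasP; exists x.
  by split; [rewrite mem_nth // -has_find | apply/eqP/(nth_find o hx)].
exists nat, c'; split.
  split; [apply: bP => x Lx | apply: bP => x Lx | move=> F1 F2 cF1 cF2].
  - rewrite -eo !c'E // => cx.
    by have /implyP/(_ (introT eqP cx))/eqP-> := c1 x Lx.
  - by rewrite -eV // !c'E ?Lv //; apply/eqP/cV.
  pose value (F : rT -> algC) i := F (e (nth o L (find (fun y => c y == i) L))).
  have valueE F : class_function B c' F -> {in L, forall x, F (e x) = value F (c x)}.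
    move=> cF x Lx; have [Lr cr] := repP x Lx.
    by apply: cF; rewrite ?eB // !c'E.
  have convE x : x \in L -> (convolution B F1 F2 (e x)
      = \sum_(q <- table_pairs x) value F1 q.1 * value F2 q.2)%R.
    move=> Lx; rewrite /convolution big_map.
    rewrite (eq_bigl (fun z => (z \in B) && xpredT z)) => [|z]; last by rewrite andbT.
    rewrite (sumB xpredT) !big_seq; apply: eq_bigr => z Lz /=.
    by rewrite -eV // -eM ?Lv // !valueE ?Lm ?Lv.
  have conv_rep x : x \in L ->
      convolution B F1 F2 (e x) = convolution B F1 F2 (e (table_rep x)).
    move=> Lx; have [Lr _] := repP x Lx.
    by rewrite !convE //; apply/perm_big/cM.
  move=> g h; rewrite !mem_B => /mapP[x Lx ->] /mapP[y Ly ->].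
  rewrite !c'E // => cxy; rewrite conv_rep // [RHS]conv_rep //.
  by rewrite /table_rep cxy.
pose phi g : algC := ((v`_(c' g))%:~R + sqrtC d%:R * (w`_(c' g))%:~R)%R.
have d0 : (sqrtC d%:R ^+ 2 = d%:R :> algC)%R by rewrite sqrtCK.
exists k, (p%:~R + sqrtC d%:R)%R, phi; split.
- rewrite rpredD ?Aint_int //.
  apply: (@root_monic_Aint ('X^2 - d%:R%:P)%R).
  + by rewrite rootE !hornerE d0 subrr.
  + by rewrite monicXnsubC.
  + apply/polyOverP=> i; rewrite coefB coefC coefXn /= -mulrb.
    by rewrite rpredB ?rpred_nat // rpredMn ?rpred_nat.
- exact: sqrtC_not_int.
- case/hasP: nz => x Lx /andP[nz /eqP w0]; exists (e x); rewrite ?eB //.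
  by rewrite /phi c'E // w0 mulr0 addr0 intr_eq0.
apply: bP => x Lx; rewrite sumB.
have applyE (u : seq int) : ((table_apply k u x)%:~R =
    \sum_(s <- L | c' (e s) == k) (u`_(c' (e x * e s)%g)%N)%:~R :> algC)%R.
  rewrite /table_apply foldrE big_map big_filter rmorph_sum.
  rewrite big_seq_cond [RHS]big_seq_cond.
  apply: eq_big => [s | s /andP[Ls _]].
    by case Ls: (s \in L) => //=; rewrite c'E.
  by rewrite -eM // c'E ?Lm.
have /andP[/eqP ev /eqP ew] := eig x Lx.
rewrite /phi big_split -big_distrr /= -!applyE ev ew c'E // !rmorphD !rmorphM /=.
have -> : ((d%:Z)%:~R = sqrtC d%:R ^+ 2 :> algC)%R by rewrite d0.
ring.
Qed.

End Table.

(** * Groups all of whose sections are integral *)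

(** A hereditary form of desirability: it passes to subgroups and to
quotients, whereas desirability itself speaks of one group only. *)
Definition integral_sections (gT : finGroupType) (G : {group gT}) :=
  forall (rT : finGroupType) (H : {group gT}) (Q : {group rT}),
    H \subset G -> Q \homg H -> ~ irrational_sring Q.

Lemma desirable_integral_sections gT :
  desirable_group gT -> integral_sections [set: gT].
Proof.
move=> desG rT H Q _ /homgP[f fH].
have -> : Q = (f @* H)%G by apply: val_inj.
by move/irrational_section; apply: desirable_no_irrational.
Qed.

Lemma integral_sectionsS (gT : finGroupType) (G H : {group gT}) :
  H \subset G -> integral_sections G -> integral_sections H.
Proof. by move=> sHG intG rT K Q sKH; apply/intG/(subset_trans sKH). Qed.

Lemma integral_sections_quotient (gT : finGroupType) (G N : {group gT}) :
  N <| G -> integral_sections G -> integral_sections (G / N).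
Proof.
move=> nNG intG rT K Q sKGN homQ.
have [H defK sNH sHG] := inv_quotientS nNG sKGN.
apply: (intG _ H Q sHG); rewrite (homg_trans homQ) // defK quotient_homg //.
exact: subset_trans sHG (normal_norm nNG).
Qed.

Lemma mem_cycle_expg (gT : finGroupType) (x : gT) n k :
  prime n -> x ^+ n = 1 -> 0 < k < n -> x \in <[x ^+ k]>.
Proof.
move=> pr_n xn1 /andP[k_gt0 lt_kn].
suffices /eqP <- : generator <[x]> (x ^+ k) by rewrite cycle_id.
rewrite generator_coprime (coprime_dvdl (n := n)) ?order_dvdn ?xn1 //.
by rewrite prime_coprime // gtnNdvd.
Qed.

(** The semidirect product of <u> x <v>, of type (p, q), by <t> of order
[n], where t acts by u^t = u^a v^b and v^t = u^c v^d.  The triple (k, i, j)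
stands for t^k u^i v^j. *)
Section SemidirectTable.

Variables (p q n a b c d : nat).

Definition sd_elements : seq (nat * nat * nat) :=
  [seq (ki, j) | ki <- [seq (k, i) | k <- iota 0 n, i <- iota 0 p],
                 j <- iota 0 q].

Definition sd_act (x : nat * nat) : nat * nat :=
  ((a * x.1 + c * x.2) %% p, (b * x.1 + d * x.2) %% q).

Definition sd_mul (x y : nat * nat * nat) : nat * nat * nat :=
  let z := iter y.1.1 sd_act (x.1.2, x.2) in
  ((x.1.1 + y.1.1) %% n, (z.1 + y.1.2) %% p, (z.2 + y.2) %% q).

Definition sd_color (classes : seq (seq (nat * nat * nat))) x :=
  find (fun C : seq _ => x \in C) classes.

(** The spectral data are those of [table_eigen]: the block [k] has the
eigenvalue s + sqrt(r), with eigenfunction [v] + sqrt(r) [w]. *)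
Definition sd_check classes k (s : int) r v w :=
  [&& table_group sd_elements (0, 0, 0) sd_mul,
      table_sring sd_elements (0, 0, 0) sd_mul (sd_color classes),
      table_eigen sd_elements sd_mul (sd_color classes) k s r v w
    & all (fun i => i * i != r)%N (iota 0 r.+1)].

Variables (gT : finGroupType) (u v t : gT).
Hypotheses (vq : v ^+ q = 1) (tn : t ^+ n = 1) (cuv : commute u v).
Hypotheses (ou : #[u] = p) (ut : u ^ t = u ^+ a * v ^+ b).
Hypotheses (vt : v ^ t = u ^+ c * v ^+ d).

Definition sd_eval (x : nat * nat * nat) := t ^+ x.1.1 * (u ^+ x.1.2 * v ^+ x.2).

Lemma sd_evalM x y : sd_eval (sd_mul x y) = sd_eval x * sd_eval y.
Proof.
have up : u ^+ p = 1 by rewrite -ou expg_order.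
pose e (z : nat * nat) := u ^+ z.1 * v ^+ z.2.
have cuvX i j : commute (u ^+ i) (v ^+ j) by apply/commuteX/commute_sym/commuteX.
have eM i j i' j' : e (i + i', j + j')%N = e (i, j) * e (i', j').
  by rewrite /e !expgD -!mulgA; congr (_ * _); rewrite !mulgA (cuvX i' j).
have e_mod i j : e (i %% p, j %% q) = e (i, j) by rewrite /e !expg_mod.
have eX i j k : e (i, j) ^+ k = e (i * k, j * k)%N.
  rewrite /e expgMn; last exact: cuvX.
  by rewrite -!expgM.
have e_act z : e (sd_act z) = e z ^ t.
  rewrite /sd_act e_mod eM /e conjMg !conjXg ut vt.
  by rewrite -!/(e (_, _)) !eX /e mulnC [(b * _)%N]mulnC [(c * _)%N]mulnC
     [(d * _)%N]mulnC.
have e_iter k z : e (iter k sd_act z) = e z ^ (t ^+ k).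
  by elim: k => [|k IHk]; rewrite ?conjg1 //= e_act IHk -conjgM -expgSr.
rewrite /sd_eval /sd_mul; case: x y => [[k i] j] [[k' i'] j'] /=.
rewrite (expg_mod _ tn) -!/(e (_, _)) e_mod eM.
case E: (iter k' sd_act (i, j)) => [i1 j1] /=.
rewrite -E e_iter expgD -!mulgA; congr (_ * _).
by rewrite mulKVg.
Qed.

Hypotheses (pr_n : prime n) (nAt : t \notin <<[set u; v]>>).
Hypothesis (qv : q = 1%N \/ prime q /\ v \notin <[u]>).

(** Since [n] is prime, a nontrivial power of [t] generates [t]; and
likewise for [v] if [q] is prime. *)
Lemma sd_eval_inj x : x \in sd_elements -> sd_eval x = 1 -> x = (0, 0, 0).
Proof.
case/allpairsP=> [[ki j] /= [/allpairsP[[k i] /= [Lk Li ->]] Lj ->]].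
move: Lk Li Lj; rewrite !mem_iota !add0n /= => lt_kn lt_ip lt_jq.
rewrite /sd_eval /= => e1.
have Au : u \in <<[set u; v]>> by rewrite mem_gen // !inE eqxx.
have Av : v \in <<[set u; v]>> by rewrite mem_gen // !inE eqxx orbT.
have k0 : k = 0.
  apply: contraNeq nAt; rewrite -lt0n => k_gt0.
  have: t \in <[t ^+ k]> by rewrite (mem_cycle_expg pr_n tn) // k_gt0.
  apply: subsetP; rewrite cycle_subG (canRL (mulgK _) e1) mul1g groupV.
  by rewrite groupM ?groupX.
move: e1; rewrite k0 mul1g => e1.
have j0 : j = 0.
  case: qv => [q1 | [pr_q nuv]]; first by move: lt_jq; rewrite q1 ltnS leqn0 => /eqP.
  apply: contraNeq nuv; rewrite -lt0n => j_gt0.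
  have: v \in <[v ^+ j]> by rewrite (mem_cycle_expg pr_q vq) // j_gt0.
  apply: subsetP; rewrite cycle_subG (canRL (mulKg _) e1) mulg1 groupV.
  exact: mem_cycle.
move: e1; rewrite j0 mulg1 => /eqP; rewrite -order_dvdn ou => p_i.
by congr (_, _, _); apply: contraTeq p_i; rewrite -lt0n => i0; rewrite gtnNdvd.
Qed.

Lemma sd_not_integral (G : {group gT}) classes k s r w1 w2 :
    sd_check classes k s r w1 w2 ->
  u \in G -> v \in G -> t \in G -> ~ integral_sections G.
Proof.
case/and4P=> ck_gp ck_sr ck_eig nsq Gu Gv Gt intG.
have irr := irrational_table ck_gp ck_sr ck_eig nsq (in2W sd_evalM) sd_eval_inj.
apply: (intG _ _ _ _ (homg_refl _) irr).
rewrite gen_subG; apply/subsetP=> g; rewrite inE => /mapP[x _ ->].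
by rewrite !groupM ?groupX.
Qed.

End SemidirectTable.

(** The dihedral group of order 8 acts regularly on the octagon with
connection set {t, tu}; the blocks are the spheres around 1, and the
eigenfunction is 2 cos(2 pi i / 8), up to scaling, on the sphere of radius i. *)
Lemma sd_check_octagon : sd_check 4 1 2 3 0 0 0
  [:: [:: (0, 0, 0)]; [:: (1, 0, 0); (1, 1, 0)]; [:: (0, 1, 0); (0, 3, 0)];
      [:: (1, 2, 0); (1, 3, 0)]; [:: (0, 2, 0)]]%N
  1%N 0%R 2 [:: 0; 1; 0; - 1; 0]%R [:: 1; 0; 0; 0; - 1]%R.
Proof. by vm_compute. Qed.

(** As for the octagon, with the dihedral group of order 12. *)
Lemma sd_check_dodecagon : sd_check 6 1 2 5 0 0 0
  [:: [:: (0, 0, 0)]; [:: (1, 0, 0); (1, 1, 0)]; [:: (0, 1, 0); (0, 5, 0)];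
      [:: (1, 2, 0); (1, 5, 0)]; [:: (0, 2, 0); (0, 4, 0)];
      [:: (1, 3, 0); (1, 4, 0)]; [:: (0, 3, 0)]]%N
  1%N 0%R 3 [:: 0; 3; 0; 0; 0; - 3; 0]%R [:: 2; 0; 1; 0; - 1; 0; - 2]%R.
Proof. by vm_compute. Qed.

(** The spheres around 1 in the Cayley graph with connection set tT, where
T = {1, uv, u^2 v} is the parabola v = u^2 in the affine plane of order 3, a
relative difference set with respect to <v>.  The graph is the Pappus graph,
and it does not matter whether t inverts u or centralises it, because T is
stable under u |-> u^-1. *)
Definition pappus_classes : seq (seq (nat * nat * nat)) :=
  [:: [:: (0, 0, 0)]; [:: (1, 0, 0); (1, 1, 1); (1, 2, 1)];
      [:: (0, 1, 0); (0, 1, 1); (0, 1, 2); (0, 2, 0); (0, 2, 1); (0, 2, 2)];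
      [:: (1, 0, 1); (1, 0, 2); (1, 1, 0); (1, 1, 2); (1, 2, 0); (1, 2, 2)];
      [:: (0, 0, 1); (0, 0, 2)]]%N.

Lemma sd_check_pappus a : a \in [:: 1; 2]%N ->
  sd_check 3 3 2 a 0 0 2 pappus_classes
    1%N 0%R 3 [:: 0; 2; 0; - 1; 0]%R [:: 2; 0; 0; 0; - 1]%R.
Proof. by rewrite !inE => /orP[] /eqP->; vm_compute. Qed.

(** The alternating group of degree 4 acts regularly on the twelve vertices
of the icosahedron; the blocks are the spheres of radius 0, 1, 2 and 3. *)
Lemma sd_check_icosahedron : sd_check 2 2 3 0 1 1 1
  [:: [:: (0, 0, 0)];
      [:: (0, 0, 1); (1, 0, 0); (1, 0, 1); (2, 0, 0); (2, 1, 0)];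
      [:: (0, 1, 0); (1, 1, 0); (1, 1, 1); (2, 0, 1); (2, 1, 1)];
      [:: (0, 1, 1)]]%N
  1%N 0%R 5 [:: 0; 1; - 1; 0]%R [:: 1; 0; 0; - 1]%R.
Proof. by vm_compute. Qed.

(** The blocks are the orbits of the dihedral group of order 8 of
automorphisms that permutes {u, u^-1, t, t^-1}.  In a representation of degree 3
the block {u, u^-1, t, t^-1} acts as diag(2, -1, -1) plus the matrix with 0 on
the diagonal and 1 elsewhere, whose eigenvalues are -2 and 1 + sqrt 3,
1 - sqrt 3. *)
Lemma sd_check_heisenberg : sd_check 3 3 3 1 1 0 1
  [:: [:: (0, 0, 0)]; [:: (0, 1, 0); (0, 2, 0); (1, 0, 0); (2, 0, 0)];
      [:: (1, 1, 0); (1, 1, 1); (1, 2, 0); (1, 2, 2);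
          (2, 1, 0); (2, 1, 2); (2, 2, 0); (2, 2, 1)];
      [:: (0, 1, 1); (0, 1, 2); (0, 2, 1); (0, 2, 2);
          (1, 0, 1); (1, 0, 2); (2, 0, 1); (2, 0, 2)];
      [:: (1, 1, 2); (1, 2, 1); (2, 1, 1); (2, 2, 2)];
      [:: (0, 0, 1); (0, 0, 2)]]%N
  1%N 1%R 3 [:: 8; 2; - 1; - 1; 2; - 4]%R [:: 0; 2; 1; - 1; - 2; 0]%R.
Proof. by vm_compute. Qed.

(** * Cyclic groups *)

Lemma prim_root_neq0 n (z : algC) : (n.-primitive_root z)%R -> z != 0%R.
Proof.
move=> prz; apply/eqP=> z0; have /eqP := prim_expr_order prz.
by rewrite z0 expr0n gtn_eqF ?(prim_order_gt0 prz) // eq_sym oner_eq0.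
Qed.

(** Otherwise z is a root of X^2 - (z + z^-1) X + 1, while the minimal
polynomial of z over the rationals is the cyclotomic polynomial, of degree
phi(n). *)
Lemma prim_root_sum_not_int n (z : algC) :
  (n.-primitive_root z)%R -> totient n > 2 -> (z + z^-1)%R \isn't a Num.int.
Proof.
move=> prz; rewrite ltnNge; apply: contra => /intrP[m zm].
have z0 := prim_root_neq0 prz.
(* With m = z + z^-1, this polynomial vanishes at z. *)
pose P : {poly rat} := ('X^2 + (1%:P + (- m)%:~R *: 'X))%R.
have sP : size P = 3.
  rewrite size_polyDl size_polyXn // ltnS (leq_trans (size_polyD _ _)) //.
  rewrite geq_max size_polyC (leq_trans (leq_b1 _)) //=.
  by rewrite (leq_trans (size_scale_leq _ _)) ?size_polyX.
have rootP : root (map_poly ratr P) z.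
  rewrite rootE !rmorphD /= map_polyXn map_polyZ /= map_polyX.
  rewrite map_polyC /= rmorph1 rmorph_int !hornerE rmorphN /= -zm.
  by apply/eqP; field.
have [q [Dq monq dvd_q]] := minCpolyP z.
have P0 : P != 0%R by rewrite -size_poly_eq0 sP.
rewrite dvd_q in rootP; have := dvdp_leq P0 rootP; rewrite sP.
rewrite -(size_map_poly (ratr : {rmorphism rat -> algC})) -Dq.
by rewrite (minCpoly_cyclotomic prz) size_cyclotomic.
Qed.

(** On an abelian group the pairs {g, g^-1} are the blocks of a Schur ring,
and every linear character is an eigenfunction. *)
Lemma irrational_cycle (rT : finGroupType) (x : rT) :
  totient #[x] > 2 -> irrational_sring <[x]>.
Proof.
move=> phi_gt2; set n := #[x].
have n_gt2 : n > 2.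
  by rewrite /n; case: #[x] phi_gt2 => [|[|[|m]]].
have [z prz] := C_prim_root_exists (order_gt0 x); rewrite -/n in prz.
have zV : (z^-1 = z ^+ n.-1)%R.
  apply: (mulIf (prim_root_neq0 prz)).
  rewrite mulVf ?(prim_root_neq0 prz) // -exprSr prednK ?order_gt0 //.
  by rewrite prim_expr_order.
pose c (g : rT) := [set g; g^-1].
have cP g h : c g = c h -> g = h \/ g = h^-1.
  by move=> /setP/(_ g); rewrite !inE eqxx => /esym/orP[]/eqP; [left | right].
have cV g : c g^-1 = c g by rewrite /c setUC invgK.
exists {set rT}, c; split.
  split=> [g _ /cP[]// | g _ | F1 F2 cF1 cF2 g h Bg Bh].
  - by rewrite invg1.
  - exact: cV.
  case/cP=> -> //; rewrite /convolution (reindex_inj invg_inj) /=.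
  apply: eq_big => [w | w]; rewrite groupV // => Bw.
  congr (_ * _)%R; first by apply: cF1; rewrite ?groupV.
  apply: cF2; rewrite ?groupM ?groupV // -cV invMg !invgK.
  by rewrite (centsP (cycle_abelian x)) // groupV.
pose phi g : algC := (if [pick i : 'I_n | (x ^+ i)%g == g] is Some i then z ^+ i else 0)%R.
have phiE i : phi (x ^+ i) = (z ^+ i)%R.
  rewrite /phi; case: pickP => [j | /(_ (Ordinal (ltn_pmod i (order_gt0 x))))].
    by rewrite eq_expg_mod_order -/n -(eq_prim_root_expr prz) => /eqP.
  by rewrite /= expg_mod_order eqxx.
exists (c x), (z + z^-1)%R, phi; split.
- rewrite rpredD ?(Aint_prim_root prz) //.
  by rewrite zV rpredX // (Aint_prim_root prz).
- exact: prim_root_sum_not_int prz phi_gt2.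
- exists 1; rewrite ?group1 // -(expg0 x) phiE expr0 oner_eq0 //.
move=> _ /cycleP[i ->].
have xV : x != x^-1.
  rewrite eq_sym eq_invg_mul -[x * x]/(x ^+ 2) -order_dvdn; apply: contraTN n_gt2.
  by move/dvdn_leq => /(_ isT); rewrite leqNgt.
rewrite (bigD1 x) ?cycle_id ?eqxx //= (big_pred1 x^-1) => [|g]; last first.
  apply/andP/eqP=> [[/andP[_ /eqP/cP[->|]]]| ->]; rewrite ?eqxx //.
  by rewrite groupV cycle_id cV eqxx eq_sym.
rewrite invg_expg -expgSr -expgD !phiE exprSr exprD -/n -zV.
ring.
Qed.

(** * Forbidden configurations *)

Lemma gen2_commute (gT : finGroupType) (u v t : gT) :
  commute u v -> t \in <<[set u; v]>> -> commute u t /\ commute v t.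
Proof.
move=> cuv At; have sub w : commute w u -> commute w v -> commute w t.
  move=> cwu cwv; have sAC : <<[set u; v]>> \subset 'C[w].
    by rewrite gen_subG subUset !sub1set; apply/andP; split;
      apply/cent1P/commute_sym.
  by apply/commute_sym/cent1P; apply: (subsetP sAC).
by split; apply: sub => //; apply: commute_sym.
Qed.

Section ForbiddenConfigurations.

Variables (gT : finGroupType) (G : {group gT}).
Hypothesis intG : integral_sections G.

Lemma totient_order x d : x \in G -> d %| #[x] -> totient d <= 2.
Proof.
move=> Gx dvd_d; rewrite leqNgt; apply/negP => phi_d.
have x_gt0 := order_gt0 x; have d_gt0 := dvdn_gt0 x_gt0 dvd_d.
have oy : #[x ^+ (#[x] %/ d)] = d.
  rewrite orderXdiv ?dvdn_div // divnA // mulKn //.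
apply: (intG (H := <[x ^+ (#[x] %/ d)]>%G) _ (homg_refl _)).
  by rewrite cycle_subG groupX.
by apply: irrational_cycle; rewrite oy.
Qed.

Lemma no_dihedral m u t : m \in [:: 4; 6] ->
  u \in G -> t \in G -> #[u] = m -> t ^+ 2 = 1 -> u ^ t = u^-1 -> False.
Proof.
move=> m46 Gu Gt ou t2 ut.
have ut' : u ^ t = u ^+ m.-1 * 1 ^+ 0 by rewrite ut mulg1 invg_expg ou.
have vt' : 1 ^ t = u ^+ 0 * 1 ^+ 0 by rewrite conj1g mulg1.
have ntA : t \notin <<[set u; 1]>>.
  apply/negP=> /(gen2_commute (commute1 u))[cut _].
  move: ut; rewrite /conjg cut mulKg => /eqP; rewrite eq_sym eq_invg_mul.
  rewrite -[u * u]/(u ^+ 2) -order_dvdn ou => /dvdn_leq.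
  by move: m46; rewrite !inE => /orP[]/eqP-> /(_ isT).
have check := sd_not_integral (expg1 1) t2 (commute1 u) ou ut' vt' isT ntA
  (or_introl erefl) _ Gu (group1 G) Gt intG.
move: m46 ut' check; rewrite !inE => /orP[]/eqP-> _ check.
  exact: check sd_check_octagon.
exact: check sd_check_dodecagon.
Qed.

Lemma no_pappus a u v t : a \in [:: 1; 2]%N ->
  u \in G -> v \in G -> t \in G -> #[u] = 3 -> #[v] = 3 -> commute u v ->
  v \notin <[u]> -> t ^+ 2 = 1 -> u ^ t = u ^+ a -> v ^ t = v^-1 -> False.
Proof.
move=> a12 Gu Gv Gt ou ov cuv nuv t2 ut vt.
have v3 : v ^+ 3 = 1 by rewrite -ov expg_order.
have ut' : u ^ t = u ^+ a * v ^+ 0 by rewrite mulg1.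
have vt' : v ^ t = u ^+ 0 * v ^+ 2 by rewrite mul1g vt invg_expg ov.
have ntA : t \notin <<[set u; v]>>.
  apply/negP=> /(gen2_commute cuv)[_ cvt].
  move: vt; rewrite /conjg cvt mulKg => /eqP; rewrite eq_sym eq_invg_mul.
  by rewrite -[v * v]/(v ^+ 2) -order_dvdn ov.
have v3' : 3 = 1%N \/ prime 3 /\ v \notin <[u]> by right.
exact: (sd_not_integral v3 t2 cuv ou ut' vt' isT ntA v3' (sd_check_pappus a12)
  Gu Gv Gt intG).
Qed.

(** Here t permutes cyclically the involutions u, v and uv of a four-group,
which characterises the alternating group of degree 4. *)
Lemma no_alternating u v t :
  u \in G -> v \in G -> t \in G -> u ^+ 2 = 1 -> v ^+ 2 = 1 -> commute u v ->
  u != 1 -> v != 1 -> u != v -> t ^+ 3 = 1 -> u ^ t = v -> v ^ t = u * v -> False.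
Proof.
move=> Gu Gv Gt u2 v2 cuv u1 v1 nuv t3 ut vt.
have ou : #[u] = 2 by apply: nt_prime_order.
have ut' : u ^ t = u ^+ 0 * v ^+ 1 by rewrite mul1g.
have vt' : v ^ t = u ^+ 1 * v ^+ 1 by [].
have ntA : t \notin <<[set u; v]>>.
  apply/negP=> /(gen2_commute cuv)[cut _].
  by move: ut nuv; rewrite /conjg cut mulKg => ->; rewrite eqxx.
have vu : 2 = 1%N \/ prime 2 /\ v \notin <[u]>.
  by right; rewrite (cycle2g ou) !inE negb_or v1 eq_sym.
exact: (sd_not_integral v2 t3 cuv ou ut' vt' isT ntA vu sd_check_icosahedron
  Gu Gv Gt intG).
Qed.

Lemma no_heisenberg u v t :
  u \in G -> v \in G -> t \in G -> #[u] = 3 -> v ^+ 3 = 1 -> commute u v ->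
  v \notin <[u]> -> t ^+ 3 = 1 -> u ^ t = u * v -> v ^ t = v -> False.
Proof.
move=> Gu Gv Gt ou v3 cuv nuv t3 ut vt.
have ut' : u ^ t = u ^+ 1 * v ^+ 1 by [].
have vt' : v ^ t = u ^+ 0 * v ^+ 1 by rewrite mul1g.
have ntA : t \notin <<[set u; v]>>.
  apply/negP=> /(gen2_commute cuv)[cut _]; case/negP: nuv.
  move: ut; rewrite /conjg cut mulKg -{1}[u]mulg1 => /mulgI <-; exact: group1.
have v3' : 3 = 1%N \/ prime 3 /\ v \notin <[u]> by right.
exact: (sd_not_integral v3 t3 cuv ou ut' vt' isT ntA v3' sd_check_heisenberg
  Gu Gv Gt intG).
Qed.

End ForbiddenConfigurations.

(** * 2-groups *)

Lemma commg_mem_quotient (gT : finGroupType) (N : {group gT}) x y :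
  x \in 'N(N) -> y \in 'N(N) -> commute (coset N x) (coset N y) -> [~ x, y] \in N.
Proof.
move=> nNx nNy /commgP/eqP cxy.
by apply: coset_idr; rewrite ?groupR // morphR.
Qed.

Section TwoGroups.

Variables (gT : finGroupType) (P : {group gT}).
Hypotheses (pP : 2.-group P) (intP : integral_sections P).

Lemma two_elt_expg4 x : x \in P -> x ^+ 4 = 1.
Proof.
move=> Px; have /p_natP[k ok] := mem_p_elt pP Px.
apply/eqP; rewrite -order_dvdn ok (dvdn_Pexp2l (p := 2) _ 2) //.
rewrite leqNgt; apply/negP=> k_gt2.
have := totient_order intP Px (d := 8).
by rewrite ok (dvdn_Pexp2l (p := 2) 3) // => /(_ k_gt2).
Qed.

Lemma two_elt_order4 x : x \in P -> x ^+ 2 != 1 -> #[x] = 4.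
Proof.
move=> Px x2; have : #[x] %| 4 by rewrite order_dvdn two_elt_expg4.
move: x2; rewrite -order_dvdn.
have : #[x] <= 4 by rewrite dvdn_leq // order_dvdn two_elt_expg4.
by case: #[x] => [|[|[|[|[|n]]]]].
Qed.

(** Two involutions generate a dihedral group, and an element of order 4 is
excluded as their product. *)
Lemma involutions_commute a b :
  a \in P -> b \in P -> a ^+ 2 = 1 -> b ^+ 2 = 1 -> commute a b.
Proof.
move=> Pa Pb a2 b2.
have aV : a^-1 = a by apply/eqP; rewrite eq_invg_mul -[a * a]/(a ^+ 2) a2.
have bV : b^-1 = b by apply/eqP; rewrite eq_invg_mul -[b * b]/(b ^+ 2) b2.
have [ab2 | ab2] := eqVneq ((a * b) ^+ 2) 1.
  have /eqP : a * b * (a * b) = 1 by [].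
  by rewrite -eq_invg_mul invMg aV bV eq_sym => /eqP.
have oab := two_elt_order4 (groupM Pa Pb) ab2.
case: (@no_dihedral _ P intP 4 (a * b) a _ _ Pa oab a2) => //.
  exact: groupM.
by rewrite conjMg conjgE mulKg invMg aV bV conjgE aV !mulgA -[a * a]/(a ^+ 2) a2 mul1g.
Qed.

End TwoGroups.

(** The square of y has order at most 2, so it is central in <a, y>, and y
becomes an involution modulo y^2.  Hence [a, y] is 1 or y^2; in the second case
a inverts y, and <a, y> is dihedral of order 8. *)
Lemma involution_central (gT : finGroupType) (P : {group gT}) a y :
  2.-group P -> integral_sections P ->
  a \in P -> y \in P -> a ^+ 2 = 1 -> commute a y.
Proof.
move=> pP intP Pa Py a2; pose H := <<[set a; y]>>%G; pose N := <[y ^+ 2]>%G.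
have sHP : H \subset P by rewrite gen_subG subUset !sub1set Pa.
have [Ha Hy] : a \in H /\ y \in H by rewrite !mem_gen // !inE eqxx ?orbT.
have y22 : (y ^+ 2) ^+ 2 = 1 by rewrite -expgM (two_elt_expg4 pP).
have cay2 : commute a (y ^+ 2).
  by apply: (involutions_commute pP intP); rewrite ?groupX.
have nNH : N <| H.
  rewrite /normal cycle_subG groupX //= gen_subG subUset !sub1set.
  have memN g : commute g (y ^+ 2) -> g \in 'N(<[y ^+ 2]>).
    by move=> cg; apply/(subsetP (cent_sub _)); rewrite cent_cycle; apply/cent1P.
  by rewrite !memN //; apply/commuteX/commute_refl.
have sHN := normal_norm nNH.
have pHN : 2.-group (H / N) by rewrite quotient_pgroup // (pgroupS sHP).
have intHN := integral_sections_quotient nNH (integral_sectionsS sHP intP).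
have : [~ a, y] \in N.
  apply: commg_mem_quotient; rewrite ?(subsetP sHN) //.
  apply: (involutions_commute pHN intHN); rewrite ?mem_quotient //.
    by rewrite -morphX ?(subsetP sHN) // a2 morph1.
  by rewrite -morphX ?(subsetP sHN) //; apply/coset_id/cycle_id.
have [y2 | y2] := eqVneq (y ^+ 2) 1.
  by rewrite /N /= y2 cycle1 inE => /commgP.
have oy2 : #[y ^+ 2] = 2 by apply: nt_prime_order.
rewrite /N /= (cycle2g oy2) !inE => /orP[/commgP // | /eqP ay].
case: (@no_dihedral _ P intP 4 y a _ Py Pa _ a2) => //.
  exact: (two_elt_order4 pP intP Py y2).
by rewrite conjg_mulR -invg_comm ay invMg mulgA mulgV mul1g.
Qed.

(** Modulo the central subgroup generated by x^2, x becomes an involution,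
hence central. *)
Lemma commg_two_group (gT : finGroupType) (P : {group gT}) x y :
    2.-group P -> integral_sections P -> x \in P -> y \in P ->
  [~ x, y] \in <[x ^+ 2]>.
Proof.
move=> pP intP Px Py; pose N := <[x ^+ 2]>%G.
have x22 : (x ^+ 2) ^+ 2 = 1 by rewrite -expgM (two_elt_expg4 pP).
have nNP : N <| P.
  rewrite /normal cycle_subG groupX //= cents_norm // cent_cycle.
  apply/subsetP=> g Pg; apply/cent1P/commute_sym.
  by apply: (involution_central pP intP); rewrite ?groupX.
have sPN := normal_norm nNP.
apply: (@commg_mem_quotient _ N); rewrite ?(subsetP sPN) //.
apply: (@involution_central _ (P / N)); rewrite ?mem_quotient ?quotient_pgroup //.
  exact: integral_sections_quotient.
by rewrite -morphX ?(subsetP sPN) //; apply/coset_id/cycle_id.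
Qed.

Section Noncommuting.

Variables (gT : finGroupType) (P : {group gT}) (x y : gT).
Hypotheses (pP : 2.-group P) (intP : integral_sections P).
Hypotheses (Px : x \in P) (Py : y \in P) (nxy : ~ commute x y).

Lemma commg_in_square g h : g \in P -> h \in P -> ~ commute g h -> [~ g, h] = g ^+ 2.
Proof.
move=> Pg Ph /commgP ngh; have := commg_two_group pP intP Pg Ph.
have [g2 | g2] := eqVneq (g ^+ 2) 1.
  by rewrite g2 cycle1 inE (negPf ngh).
have og2 : #[g ^+ 2] = 2.
  by apply: nt_prime_order g2; rewrite // -expgM (two_elt_expg4 pP).
by rewrite (cycle2g og2) !inE (negPf ngh) => /eqP.
Qed.

Let xy : [~ x, y] = x ^+ 2. Proof. exact: commg_in_square. Qed.

Let x4 : x ^+ 4 = 1. Proof. exact: (two_elt_expg4 pP intP). Qed.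

Let x2_central g : g \in P -> commute (x ^+ 2) g.
Proof.
move=> Pg; apply: (involution_central pP intP); rewrite ?groupX //.
by rewrite -expgM.
Qed.

Let x2_neq1 : x ^+ 2 != 1.
Proof. by rewrite -xy; apply/commgP. Qed.

Lemma square_eq : y ^+ 2 = x ^+ 2.
Proof.
have nyx : ~ commute y x by move/commute_sym.
rewrite -(commg_in_square Py Px nyx) -invg_comm xy.
by apply/eqP; rewrite eq_invg_mul -expgD x4.
Qed.

Lemma isog_quaternion : <<[set x; y]>> \isog 'Q_8.
Proof.
have sQ : 2 < 3 by [].
rewrite isogEcard (card_quaternion sQ) /=; apply/andP; split.
  rewrite (Grp_quaternion sQ); apply/existsP; exists (x, y) => /=.
  rewrite !xpair_eqE /= joing_idl joing_idr eqxx x4 square_eq eqxx /=.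
  rewrite eqxx conjg_mulR xy; apply/eqP/(mulgI x).
  by rewrite mulgV.
have Qx : x \in <<[set x; y]>> by rewrite mem_gen // !inE eqxx.
have ox : #[x] = 4 by exact: (two_elt_order4 pP intP Px x2_neq1).
have sxQ : <[x]> \subset <<[set x; y]>> by rewrite cycle_subG.
rewrite -(Lagrange sxQ) -orderE ox -[(2 ^ 3)%N]/(4 * 2)%N leq_mul2l /=.
rewrite indexg_gt1 gen_subG subUset !sub1set cycle_id /=.
apply/negP=> xy_cyc; apply: nxy.
by apply: (centsP (cycle_abelian x)) xy_cyc; apply: cycle_id.
Qed.

Let Q := <<[set x; y]>>%G.
Let C := 'C_P(Q)%G.

Let Qx : x \in Q. Proof. by rewrite mem_gen // !inE eqxx. Qed.
Let Qy : y \in Q. Proof. by rewrite mem_gen // !inE eqxx orbT. Qed.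

Let sQP : Q \subset P.
Proof. by rewrite gen_subG subUset !sub1set Px. Qed.

Let mem_C g : g \in P -> commute x g -> commute y g -> g \in C.
Proof.
move=> Pg cxg cyg; rewrite inE Pg /= cent_gen; apply/centP=> h.
by rewrite !inE => /orP[] /eqP->; apply/commute_sym.
Qed.

Let C_commute g h : g \in C -> h \in Q -> commute h g.
Proof. by case/setIP=> _ /centP cg Qh; apply/commute_sym/cg. Qed.

(** An element of P multiplies x, and y, by 1 or by the central involution
x^2, and the four possibilities are realised by conjugation with 1, x, y
and xy. *)
Lemma mul_quaternion_cent : Q * C = P.
Proof.
apply/eqP; rewrite eqEsubset mul_subG ?subsetIl //=; apply/subsetP=> g Pg.
suffices [q Qq [exq eyq]] : exists2 q, q \in Q & x ^ g = x ^ q /\ y ^ g = y ^ q.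
  have Cgq : g * q^-1 \in C.
    have fixC h : h ^ g = h ^ q -> commute h (g * q^-1).
      by move=> eh; apply/commgP/conjg_fixP; rewrite conjgM eh conjgK.
    have Pq : q \in P by apply: (subsetP sQP).
    by apply: mem_C; [rewrite groupM ?groupV | apply: fixC | apply: fixC].
  apply/imset2P; exists q (g * q^-1) => //.
  by rewrite (C_commute Cgq Qq) mulgKV.
have conjX h : h \in P -> h ^ g = h \/ h ^ g = h * h ^+ 2.
  move=> Ph; rewrite conjg_mulR.
  have [-> |/commgP n1] := eqVneq [~ h, g] 1; first by left; rewrite mulg1.
  by right; rewrite commg_in_square.
have nyx : ~ commute y x by move/commute_sym.
have xyE : x ^ y = x * x ^+ 2 by rewrite conjg_mulR xy.
have yxE : y ^ x = y * y ^+ 2 by rewrite conjg_mulR commg_in_square.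
have xxE : x ^ x = x by rewrite conjgE mulKg.
have yyE : y ^ y = y by rewrite conjgE mulKg.
have [ex | ex] := conjX x Px; have [ey | ey] := conjX y Py.
- by exists 1; rewrite ?group1 // !conjg1.
- by exists x; rewrite // xxE yxE.
- by exists y; rewrite // xyE yyE.
exists (x * y); first by rewrite groupM.
rewrite !conjgM xxE yxE xyE conjMg yyE conjXg yyE; split=> //.
Qed.

(** If w centralises x and y then xw does not commute with y, so that
(xw)^2 = [xw, y] = [x, y] = x^2, whence w^2 = 1. *)
Lemma abelem_quaternion_cent : 2.-abelem C.
Proof.
have w2 w : w \in C -> w ^+ 2 = 1.
  move=> Cw; have Pw : w \in P by case/setIP: Cw.
  have cxw := C_commute Cw Qx; have cyw := C_commute Cw Qy.
  have xwy : [~ x * w, y] = x ^+ 2.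
    rewrite commMgJ xy; have /commgP/eqP-> := commute_sym cyw.
    by rewrite mulg1 conjXg conjgE cxw mulKg.
  have nxwy : ~ commute (x * w) y by apply/commgP; rewrite xwy.
  have := commg_in_square (groupM Px Pw) Py nxwy.
  by rewrite xwy expgMn // -{1}[x ^+ 2]mulg1 => /mulgI.
apply/abelemP=> //; split=> //; apply/centsP=> g Cg h Ch.
have [[Pg _] [Ph _]] := (setIP Cg, setIP Ch).
by apply: (involution_central pP intP) => //; apply: w2.
Qed.

(** In x^i y^j, an odd exponent would make x commute with y. *)
Lemma quaternion_cent_TI : Q :&: C \subset <[x ^+ 2]>.
Proof.
have nxy2 : <[y]> \subset 'N(<[x]>).
  rewrite cycle_subG; apply/normP; rewrite -cycleJ conjg_mulR xy -expgS.
  apply/eqP; rewrite eq_sym [_ == _](@generator_coprime _ x 3).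
  by rewrite (two_elt_order4 pP intP Px x2_neq1).
have defQ : <[x]> * <[y]> = Q.
  by rewrite -norm_joinEr //= joing_idl joing_idr.
have even_exp (g h : gT) k : commute (g ^+ 2) h -> ~ commute g h ->
    commute (g ^+ k) h -> g ^+ k \in <[g ^+ 2]>.
  move=> cg2h ngh; rewrite -(odd_double_half k) expgD -mul2n expgM.
  have cgk : commute ((g ^+ 2) ^+ k./2) h by apply/commute_sym/commuteX/commute_sym.
  case: (odd k) => [cgh | _]; last by rewrite mul1g mem_cycle.
  case: ngh; rewrite -[g](mulgK ((g ^+ 2) ^+ k./2)); apply/commute_sym.
  by apply: commuteM; [|apply: commuteV]; apply: commute_sym.
apply/subsetP=> g /setIP[Qg Cg].
have [cxg cyg] := (C_commute Cg Qx, C_commute Cg Qy).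
move: Qg; rewrite -defQ => /imset2P[_ _ /cycleP[i ->] /cycleP[j ->] eg].
have nyx : ~ commute y x by move/commute_sym.
have cyj : commute (y ^+ j) x.
  have -> : y ^+ j = x ^- i * g by rewrite eg mulKg.
  by apply/commute_sym/commuteM => //; apply/commuteV/commuteX/commute_refl.
have cxi : commute (x ^+ i) y.
  have -> : x ^+ i = g * y ^- j by rewrite eg mulgK.
  by apply/commute_sym/commuteM => //; apply/commuteV/commuteX/commute_refl.
have cx := even_exp x y i (x2_central Py) nxy cxi.
have := even_exp y x j _ nyx cyj; rewrite square_eq => /(_ (x2_central Px)) cy.
by rewrite eg groupM.
Qed.

Lemma two_group_isog : exists m : nat, P \isog [set: 'Q_8 * 'rV['Z_2]_m].
Proof.
have Cz : <[x ^+ 2]> \subset C.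
  rewrite cycle_subG mem_C ?groupX //; last exact/commute_sym/x2_central.
  exact/commuteX/commute_refl.
have /splitsP[D /complP[tiD defC]] := abelem_splits abelem_quaternion_cent Cz.
have sDC : D \subset C by rewrite -defC mulG_subr.
have abelD := abelemS sDC abelem_quaternion_cent.
exists (logn 2 #|D|).
have defP : Q \x D = P.
  rewrite dprodE ?(subset_trans sDC) ?subsetIr //.
    rewrite -mul_quaternion_cent -defC mulgA; congr (_ * _).
    by rewrite mulGSid // cycle_subG groupX.
  apply/trivgP; rewrite -tiD subsetI subsetIr andbT.
  by rewrite (subset_trans _ quaternion_cent_TI) // setIS.
set m := logn 2 #|D|; pose V := [set: 'rV['Z_2]_m]%G.
have isoD : D \isog V.
  rewrite (isog_abelem_card _ abelD) (mx_Fp_abelem 1 m (isT : prime 2)) /=.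
  by rewrite cardsT card_mx card_ord mul1n (card_pgroup (abelem_pgroup abelD)).
have -> : [set: 'Q_8 * 'rV['Z_2]_m] = setX 'Q_8 V.
  by apply/setP=> -[g h]; rewrite !inE.
apply: (isog_dprod defP (setX_dprod 'Q_8 V)).
  exact: isog_trans isog_quaternion (isog_setX1 _ _).
exact: isog_trans isoD (isog_set1X _ _).
Qed.

End Noncommuting.

(** * Elements of order 3 *)

Lemma three_elt_expg3 (gT : finGroupType) (P : {group gT}) x :
  3.-group P -> integral_sections P -> x \in P -> x ^+ 3 = 1.
Proof.
move=> pP intP Px; have /p_natP[k ok] := mem_p_elt pP Px.
apply/eqP; rewrite -order_dvdn ok (dvdn_Pexp2l (p := 3) _ 1) //.
rewrite leqNgt; apply/negP=> k_gt1.
have := totient_order intP Px (d := 9).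
by rewrite ok (dvdn_Pexp2l (p := 3) 2) // => /(_ k_gt1).
Qed.

(** In a nonabelian P, take u in the second centre but not in the centre,
and t not commuting with u: then [u, t] is central, and u, t generate a
Heisenberg group. *)
Lemma three_group_abelem (gT : finGroupType) (P : {group gT}) :
  3.-group P -> integral_sections P -> 3.-abelem P.
Proof.
move=> pP intP; apply/abelemP=> //; split=> [|x]; last exact: three_elt_expg3.
apply: contraT => nabP; pose Z := 'Z(P)%G.
have nZP : P \subset 'N(Z) by apply: normal_norm (center_normal P).
have nt_PZ : P / Z != 1.
  apply: contra nabP => /eqP/trivgP; rewrite quotient_sub1 // => sPZ.
  by apply: (abelianS sPZ); apply: center_abelian.
have : 'Z(P / Z) != 1.
  by apply: contra nt_PZ => /eqP/(trivg_center_pgroup (quotient_pgroup _ pP))->.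
case/trivgPn=> ub /setIP[/morphimP[u nZu Pu ->{ub}] cu] ntu.
have nZ_u : u \notin Z by apply: contraNN ntu => Zu; rewrite /= coset_id.
have [t Pt nut] : exists2 t, t \in P & [~ u, t] != 1.
  apply/exists_inP; apply: contraR nZ_u => /exists_inPn cut.
  rewrite inE Pu; apply/centP=> t Pt; apply/commgP.
  by have := cut t Pt; rewrite negbK.
have Zv : [~ u, t] \in Z.
  apply: commg_mem_quotient; rewrite ?(subsetP nZP) //.
  by apply: (centP cu); rewrite mem_quotient.
have cZ g h : g \in Z -> h \in P -> commute g h by case/setIP=> _ /centP cg /cg.
have ou : #[u] = 3.
  apply: nt_prime_order; rewrite ?(three_elt_expg3 pP) //.
  by apply: contraNneq nZ_u => ->; apply: group1.
set v := [~ u, t] in nut Zv; have Pv : v \in P by case/setIP: Zv.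
have ov : #[v] = 3 by apply: nt_prime_order; rewrite ?(three_elt_expg3 pP).
case: (@no_heisenberg _ P intP u v t) => //.
- by rewrite -ov expg_order.
- exact/commute_sym/cZ.
- apply: contra nZ_u => uv; have : u \in <[v]>.
    suffices /eqP-> : <[v]> == <[u]> by apply: cycle_id.
    by rewrite eqEcard cycle_subG uv -!orderE ou ov.
  by apply: subsetP; rewrite cycle_subG.
- exact: three_elt_expg3 pP intP Pt.
- exact: conjg_mulR.
by apply/conjg_fixP/commgP/cZ.
Qed.

(** If a, b = a^x and c = b^x are distinct, then x permutes cyclically the
involutions ab, bc and ca of a four-group. *)
Lemma order3_cent_involution (gT : finGroupType) (G Q : {group gT}) a x :
    integral_sections G -> Q \subset G -> 2.-group Q ->
  x \in G -> x \in 'N(Q) -> x ^+ 3 = 1 -> a \in Q -> a ^+ 2 = 1 -> commute a x.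
Proof.
move=> intG sQG pQ Gx nQx x3 Qa a2.
have intQ := integral_sectionsS sQG intG.
have Qb : a ^ x \in Q by rewrite memJ_norm.
have Qc : (a ^ x) ^ x \in Q by rewrite !memJ_norm.
have cax : ((a ^ x) ^ x) ^ x = a by rewrite -!conjgM -[x * (x * x)]/(x ^+ 3) x3 conjg1.
have sqJ g : g ^+ 2 = 1 -> (g ^ x) ^+ 2 = 1 by move=> g2; rewrite -conjXg g2 conj1g.
have com g h := involution_central (a := g) (y := h) pQ intQ.
have [e | nab] := eqVneq (a ^ x) a; first by apply/commgP/conjg_fixP.
set b := a ^ x in Qb Qc cax nab; set c := b ^ x in Qc cax.
have b2 : b ^+ 2 = 1 by apply: sqJ.
have c2 : c ^+ 2 = 1 by apply: sqJ.
have sqM (g h : gT) : g ^+ 2 = 1 -> h ^+ 2 = 1 -> commute g h -> (g * h) ^+ 2 = 1.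
  by move=> g2 h2 cgh; rewrite expgMn // g2 h2 mulg1.
have gV (g : gT) : g ^+ 2 = 1 -> g^-1 = g.
  by move=> g2; apply/eqP; rewrite eq_invg_mul -[g * g]/(g ^+ 2) g2.
have ab1 : a * b != 1 by rewrite -eq_invg_mul gV // eq_sym.
have sub g : g \in Q -> g \in G by apply: subsetP.
case: (@no_alternating _ G intG (a * b) (b * c) x) => //.
- by rewrite groupM ?sub.
- by rewrite groupM ?sub.
- by apply: sqM => //; apply: com.
- by apply: sqM => //; apply: com.
- apply: (com); [exact: groupM | exact: groupM |].
  by apply: sqM => //; apply: com.
- have -> : b * c = (a * b) ^ x by rewrite conjMg.
  by rewrite conjg_eq1.
- have cab : commute a b by apply: (com).
  rewrite [a * b]cab; apply: contraNneq nab => /mulgI eac.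
  by rewrite -cax -eac.
- by rewrite conjMg.
rewrite conjMg -/c cax mulgA -(mulgA a) -[b * b]/(b ^+ 2) b2 mulg1.
by apply: (com).
Qed.

(** The element x centralises y^2 by the previous lemma, and modulo y^2 it
centralises the image of y for the same reason.  So y^x = yw with w in <y^2>
fixed by x; then w^3 = 1, and w = 1. *)
Lemma order3_cent_2group (gT : finGroupType) (G Q : {group gT}) x :
    integral_sections G -> Q \subset G -> 2.-group Q ->
  x \in G -> x \in 'N(Q) -> x ^+ 3 = 1 -> x \in 'C(Q).
Proof.
move=> intG sQG pQ Gx nQx x3; apply/centP=> y Qy.
have intQ := integral_sectionsS sQG intG.
pose N := <[y ^+ 2]>%G; pose H := (Q <*> <[x]>)%G.
have y22 : (y ^+ 2) ^+ 2 = 1 by rewrite -expgM (two_elt_expg4 pQ).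
have Qy2 : y ^+ 2 \in Q by rewrite groupX.
have cy2x : commute (y ^+ 2) x.
  exact: (order3_cent_involution intG sQG pQ Gx nQx x3 Qy2 y22).
have sHG : H \subset G by rewrite join_subG sQG cycle_subG.
have sQH : Q \subset H by rewrite joing_subl.
have Hx : x \in H by rewrite mem_gen // inE cycle_id orbT.
have nNH : N <| H.
  rewrite /normal cycle_subG (subsetP sQH) //= cents_norm // cent_cycle join_subG.
  rewrite cycle_subG; apply/andP; split; last by apply/cent1P/commute_sym.
  apply/subsetP=> g Qg; apply/cent1P/commute_sym.
  exact: (involution_central pQ intQ).
have sHN := normal_norm nNH; have sQN := subset_trans sQH sHN.
have intHN := integral_sections_quotient nNH (integral_sectionsS sHG intG).
have [nNx nNy] : x \in 'N(N) /\ y \in 'N(N).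
  by split; [apply: (subsetP sHN) | apply: (subsetP sQN)].
have Nyx : [~ y, x] \in N.
  apply: commg_mem_quotient => //.
  apply: (@order3_cent_involution _ (H / N) (Q / N)); rewrite ?quotientS ?mem_quotient //.
  - exact: quotient_pgroup.
  - have: coset N x \in 'N(Q) / N by rewrite mem_quotient.
    exact/subsetP/quotient_norm.
  - by rewrite -morphX // x3 morph1.
  - by rewrite -morphX //; apply/coset_id/cycle_id.
have cNx g : g \in N -> g ^ x = g.
  by case/cycleP=> k ->; rewrite conjXg; congr (_ ^+ k); apply/conjg_fixP/commgP.
have eyx := conjg_mulR y x; set w := [~ y, x] in Nyx eyx.
have eyk k : y ^ (x ^+ k) = y * w ^+ k.
  elim: k => [|k IHk]; first by rewrite conjg1 mulg1.
  have Nwk : w ^+ k \in N by apply: groupX.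
  by rewrite expgSr conjgM IHk conjMg eyx (cNx _ Nwk) -mulgA -expgS.
have w3 : w ^+ 3 = 1.
  by apply: (mulgI y); rewrite -eyk x3 conjg1 mulg1.
have w2 : w ^+ 2 = 1.
  by case/cycleP: Nyx => k ->; rewrite -expgM mulnC expgM y22 expg1n.
have w1 : w = 1 by rewrite expgSr w2 mul1g in w3.
by apply/commute_sym/commgP; rewrite -/w w1.
Qed.

(** * The normal Sylow 3-subgroup *)

Lemma integral_pi (gT : finGroupType) (G : {group gT}) p :
  integral_sections G -> p \in primes #|G| -> p \in [:: 2; 3].
Proof.
move=> intG; rewrite mem_primes => /and3P[pr_p _ p_dvd].
have [x Gx ox] := Cauchy pr_p p_dvd.
have := totient_order intG Gx (dvdnn _); rewrite ox totient_prime //.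
by case: p pr_p {p_dvd ox} => [|[|[|[|p]]]].
Qed.

Lemma integral_p'group (gT : finGroupType) (G : {group gT}) p q :
  (p, q) \in [:: (2, 3); (3, 2)] -> integral_sections G ->
  q^'.-group G -> p.-group G.
Proof.
move=> pq intG; apply: sub_in_pnat => r.
move=> rG; rewrite !inE => nrq.
have := integral_pi intG rG.
by move: pq nrq; rewrite !inE => /orP[] /eqP[-> ->] /negPf->; rewrite ?orbF.
Qed.

Lemma integral_solvable (gT : finGroupType) (G : {group gT}) :
  integral_sections G -> solvable G.
Proof.
move=> intG; apply: Burnside_p_a_q_b.
rewrite -[2]/(size [:: 2; 3]) uniq_leq_size ?primes_uniq // => p.
exact: integral_pi.
Qed.

(** Otherwise C = C_G(F) has a nontrivial image in G / F, and the preimage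
in C of a nontrivial abelian normal subgroup of G / F contained in that image is normal
in G and nilpotent of class at most 2, but not contained in F. *)
Lemma solvable_cent_Fitting (gT : finGroupType) (G : {group gT}) :
  solvable G -> 'C_G('F(G)) \subset 'F(G).
Proof.
move=> solG; apply: contraT => nsCF; pose F := 'F(G)%G; pose C := 'C_G(F)%G.
have nFG : F <| G := Fitting_normal G; have nGF := normal_norm nFG.
have nCG : C <| G.
  by have := subcent_normal G F; rewrite (setIidPl nGF).
have sCG := normal_sub nCG; have nCF := subset_trans sCG nGF.
have ntCF : C / F != 1.
  by apply: contra nsCF => /eqP/trivgP; rewrite quotient_sub1.
have solCF := quotient_sol F (solvableS sCG solG).
have [M [sMC nMG ntM]] := solvable_norm_abelem solCF (quotient_normal F nCG) ntCF.
case/is_abelemP=> p _ /abelem_abelian cMM.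
pose D := (C :&: coset F @*^-1 M)%G.
have nDG : D <| G.
  by apply: normalI => //; rewrite -(quotientGK nFG) cosetpre_normal.
have sDC : D \subset C by apply: subsetIl.
have sDF : D \subset 'N(F) := subset_trans sDC nCF.
have sDM : D \subset coset F @*^-1 M := subsetIr C _.
have [mb /setD1P[ntm Mm]] : exists mb, mb \in M^#.
  by apply/set0Pn; rewrite setD_eq0 subG1.
have /morphimP[c nFc Cc mE] := subsetP sMC mb Mm.
have Dc : c \in D.
  by apply/setIP; split=> //; apply/morphpreP; split=> //; rewrite -mE.
have sD'F : D^`(1) \subset F.
  apply: (der1_min sDF); apply: abelianS cMM.
  by rewrite sub_quotient_pre.
have nilD : nilpotent D.
  rewrite -quotient_center_nil; apply/abelian_nil/sub_der1_abelian.
  rewrite subsetI der_sub; apply: (subset_trans sD'F).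
  by rewrite centsC (subset_trans sDC) // subsetIr.
have Fc : c \in F := subsetP (Fitting_max nDG nilD) c Dc.
by case/eqP: ntm; rewrite mE /= coset_id.
Qed.

(** The Fitting subgroup of G / O_3(G) is a 2-group, so it is centralised
by every element of order 3; but it contains its own centraliser. *)
Lemma quotient_pcore3_2group (gT : finGroupType) (G : {group gT}) :
  integral_sections G -> 2.-group (G / 'O_3(G)).
Proof.
move=> intG; have intGb := integral_sections_quotient (pcore_normal 3 G) intG.
set Gb := (G / 'O_3(G))%G in intGb *.
apply: (@integral_p'group _ Gb 2 3) => //; rewrite /pgroup p'natE //.
apply/negP=> /Cauchy[] // x Gx ox.
have sFG : 'F(Gb) \subset Gb := Fitting_sub Gb.
have pF : 2.-group 'F(Gb).
  apply: (@integral_p'group _ 'F(Gb) 2 3) => //.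
    exact: integral_sectionsS intGb.
  have := nilpotent_pcoreC 3 (Fitting_nil Gb).
  rewrite p_core_Fitting trivg_pcore_quotient dprod1g => <-.
  exact: pcore_pgroup.
have cxF : x \in 'C('F(Gb)).
  apply: (order3_cent_2group intGb sFG pF) => //.
    exact: subsetP (gFnorm _ _) x Gx.
  by apply/eqP; rewrite -order_dvdn ox.
have Fx : x \in 'F(Gb).
  apply: (subsetP (solvable_cent_Fitting (integral_solvable intGb))).
  by rewrite inE Gx.
by have := mem_p_elt pF Fx; rewrite /p_elt ox.
Qed.

Lemma integral_sdprod (gT : finGroupType) (G : {group gT}) :
  integral_sections G -> exists P Q : {group gT},
    [/\ P ><| Q = G, 3.-group P & 2.-group Q].
Proof.
move=> intG; have pGb := quotient_pcore3_2group intG.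
have nPG := pcore_normal 3 G; have pP := pcore_pgroup 3 G.
have index2 : 2.-nat #|G : 'O_3(G)|.
  by rewrite -card_quotient ?normal_norm.
have hallP : Hall G 'O_3(G).
  rewrite /Hall normal_sub //=; apply: (pnat_coprime pP).
  by apply: sub_in_pnat index2 => r _; rewrite !inE => /eqP->.
have /splitsP[Q /complP[tiPQ defG]] := SchurZassenhaus_split hallP nPG.
exists 'O_3(G)%G, Q; split=> //.
  by rewrite sdprodE // (subset_trans _ (normal_norm nPG)) // -defG mulG_subr.
have oG : (#|'O_3(G)| * #|Q| = #|G|)%N by rewrite -(TI_cardMg tiPQ) defG.
by move: index2; rewrite /pgroup -divgS ?normal_sub // -oG mulKn.
Qed.

Lemma order3_cases (gT : finGroupType) (u h : gT) :
  #[u] = 3 -> h \in <[u]> -> [\/ h = 1, h = u | h = u^-1].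
Proof.
move=> ou; have uV : u^-1 = u ^+ 2 by rewrite invg_expg ou.
move=> /cyclePmin[i]; rewrite ou uV.
case: i => [|[|[|i]]] // _ ->; by [constructor 1 | constructor 2 | constructor 3].
Qed.

(** For g in P not fixed by t, the element u = [g, t] is inverted by t.  If
w in P lies outside <u>, then either [w, t] is a second element inverted by t,
independent of u, or w w^t is an element fixed by t and independent of u;
these are the two Pappus configurations. *)
Lemma abelem3_involution (gT : finGroupType) (G P : {group gT}) t :
    integral_sections G -> P \subset G -> 3.-abelem P ->
    t \in G -> t \in 'N(P) -> t ^+ 2 = 1 -> t \notin 'C(P) ->
  exists2 u, P :=: <[u]> & #[u] = 3 /\ u ^ t = u^-1.
Proof.
move=> intG sPG abelP Gt nPt t2 ncPt.
have sub g : g \in P -> g \in G by apply: subsetP.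
have ord g : g \in P -> g != 1 -> #[g] = 3 by apply: abelem_order_p.
have com g h : g \in P -> h \in P -> commute g h.
  by move=> Pg Ph; apply: (centsP (abelem_abelian abelP)).
have PJ g : g \in P -> g ^ t \in P by rewrite memJ_norm.
have tt g : (g ^ t) ^ t = g by rewrite -conjgM -[t * t]/(t ^+ 2) t2 conjg1.
have invJ g : (g^-1 * g ^ t) ^ t = (g^-1 * g ^ t)^-1.
  by rewrite conjMg conjVg tt [RHS]invMg invgK.
have [g Pg ngt] : exists2 g, g \in P & g ^ t != g.
  apply/exists_inP; apply: contraR ncPt => /exists_inPn fix_t.
  apply/centP=> g Pg; apply/commute_sym/commgP/conjg_fixP/eqP.
  by have := fix_t g Pg; rewrite negbK.
pose u := g^-1 * g ^ t; have Pu : u \in P by rewrite groupM ?groupV ?PJ.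
have ou : #[u] = 3.
  by apply: ord => //; rewrite /u -eq_mulVg1 eq_sym.
exists u; last by split; [|apply: invJ].
apply/eqP; rewrite eqEsubset cycle_subG Pu andbT; apply/subsetP=> w Pw.
apply: contraT => nuw.
pose v := w^-1 * w ^ t; have Pv : v \in P by rewrite groupM ?groupV ?PJ.
have [uv | nuv] := boolP (v \in <[u]>); last first.
  have ov : #[v] = 3.
    by apply: ord => //; apply: contraNneq nuv => ->.
  case: (@no_pappus _ G intG 2 u v t) => //; try exact: sub.
  - exact: com.
  - by rewrite invJ invg_expg ou.
  - exact: invJ.
(* As v = w^-2 s lies in <u> and w has order 3, s is outside <u> with w. *)
pose s := w * w ^ t; have Ps : s \in P by rewrite groupM ?PJ.
have nus : s \notin <[u]>.
  apply: contra nuw => us.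
  have : s * v^-1 \in <[u]> by rewrite groupM ?groupV.
  rewrite /s /v invMg invgK mulgA mulgK => uww.
  have -> : w = (w * w) ^+ 2.
    have w3 : w ^+ 3 = 1 by have [_] := abelemP (isT : prime 3) abelP; exact.
    by rewrite -[w * w]/(w ^+ 2) -expgM (expgD w 3 1) w3 mul1g.
  exact: groupX.
have os : #[s] = 3.
  by apply: ord => //; apply: contraNneq nus => ->.
case: (@no_pappus _ G intG 1%N s u t) => //; try exact: sub.
- exact: com.
- apply: contra nus => su; suffices /eqP-> : <[u]> == <[s]> by apply: cycle_id.
  by rewrite eqEcard cycle_subG su -!orderE ou os.
- by rewrite conjMg tt; apply: com; rewrite ?PJ.
exact: invJ.
Qed.

(** * Nontrivial action on the Sylow 3-subgroup *)

(** Reduces to the case of an involution by dividing out <y^2>, which meets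
P trivially. *)
Lemma abelem3_two_elt (gT : finGroupType) (G P : {group gT}) y :
    integral_sections G -> P \subset G -> 3.-abelem P ->
    y \in G -> y \in 'N(P) -> y ^+ 4 = 1 -> y ^+ 2 \in 'C(P) -> y \notin 'C(P) ->
  exists2 u, P :=: <[u]> & #[u] = 3 /\ u ^ y = u^-1.
Proof.
move=> intG sPG abelP Gy nPy y4 cPy2 ncPy.
pose H := (P <*> <[y]>)%G; pose N := <[y ^+ 2]>%G.
have sHG : H \subset G by rewrite join_subG sPG cycle_subG.
have sPH : P \subset H by rewrite joing_subl.
have Hy : y \in H by rewrite mem_gen // inE cycle_id orbT.
have nNH : N <| H.
  rewrite /normal cycle_subG groupX //= cents_norm // cent_cycle join_subG cycle_subG.
  rewrite sub_cent1 cPy2; apply/cent1P/commuteX/commute_refl.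
have sHN := normal_norm nNH; have sPN := subset_trans sPH sHN.
have nNy : y \in 'N(N) by apply: (subsetP sHN).
have pN : 2.-group N.
  rewrite /pgroup -orderE; apply: (@pnat_dvd _ 2) => //.
  by rewrite order_dvdn -expgM y4.
have tiNP : N :&: P = 1.
  by rewrite coprime_TIg // (pnat_coprime pN) //
    (sub_in_pnat _ (abelem_pgroup abelP)) // => r _ /eqnP->.
have isoP : P \isog P / N by apply: quotient_isog => //.
have intHN := integral_sections_quotient nNH (integral_sectionsS sHG intG).
have ncyb : coset N y \notin 'C(P / N).
  apply: contra ncPy => /centP cyb; apply/centP=> g Pg.
  have nNg : g \in 'N(N) by apply: (subsetP sPN).
  have : [~ y, g] \in N :&: P.
    rewrite inE; apply/andP; split.
      by apply: commg_mem_quotient => //; apply: cyb; rewrite mem_quotient.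
    by rewrite commgEr groupM // memJ_norm ?groupV.
  by rewrite tiNP => /set1P/eqP/commgP.
have [ub Pub [oub _]] : exists2 ub,
    (P / N)%G :=: <[ub]> & #[ub] = 3 /\ ub ^ coset N y = ub^-1.
  apply: (@abelem3_involution _ (H / N)) => //.
  - exact: quotientS.
  - by rewrite -(isog_abelem isoP).
  - exact: mem_quotient.
  - have: coset N y \in 'N(P) / N by apply: mem_quotient.
    exact/subsetP/quotient_norm.
  by rewrite -morphX //; apply/coset_id/cycle_id.
have oP : #|P| = 3 by rewrite (card_isog isoP) -oub orderE -Pub.
have /cyclicP[u Pu] : cyclic P by rewrite prime_cyclic // oP.
have ou : #[u] = 3 by rewrite orderE -Pu.
exists u => //; split=> //.
have : u ^ y \in <[u]> by rewrite -Pu memJ_norm // Pu cycle_id.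
case/(order3_cases ou) => // [/eqP|uy].
  by rewrite conjg_eq1 => /eqP u1; rewrite u1 order1 in ou.
case/negP: ncPy; rewrite Pu cent_cycle; apply/cent1P/commute_sym/commgP.
exact/conjg_fixP.
Qed.

(** As x^3 = 1, the last relation says that y^-1 x y = x^2, so that
x^(y^k) = x^(2^k), which is all that is needed to map G onto any group
satisfying it. *)
Lemma dicyclic12_isog (gT : finGroupType) (G : {group gT}) u y :
    <[u]> ><| <[y]> = G -> #[u] = 3 -> #[y] = 4 -> u ^ y = u^-1 ->
  G \isog Grp (x : y : x ^+ 3 = y ^+ 4 = 1, y^-1 * x * y = x^-1).
Proof.
move=> sdG ou oy uy; have /sdprodP[_ defG nuy _] := sdG.
have conjX (rT : finGroupType) (v z : rT) k :
    v ^ z = v ^+ 2 -> v ^ (z ^+ k) = v ^+ (2 ^ k).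
  move=> vz; elim: k => [|k IHk]; first by rewrite conjg1.
  by rewrite expgSr conjgM IHk conjXg vz -expgM expnS.
have uy2 : u ^ y = u ^+ 2 by rewrite uy invg_expg ou.
apply: intro_isoGrp => [|rT H].
  apply/existsP; exists (u, y); rewrite /= !xpair_eqE norm_joinEr // defG eqxx.
  by rewrite -{1}ou -oy !expg_order -mulgA -conjgE uy !eqxx.
case/existsP=> -[a b] /=; rewrite !xpair_eqE -mulgA -conjgE.
case/and4P=> /eqP defH /eqP a3 /eqP b4 /eqP ab.
have oa : #[a] %| #[u] by rewrite ou order_dvdn a3.
have ob : #[b] %| #[y] by rewrite oy order_dvdn b4.
have ab2 : a ^ b = a ^+ 2 by rewrite ab; apply/eqP; rewrite eq_invg_mul -expgS a3.
have actB : {in <[u]> & <[y]>, morph_act 'J 'J (eltm oa) (eltm ob)}.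
  move=> _ _ /cycleP[i ->] /cycleP[j ->] /=.
  by rewrite conjXg conjX // -!expgM !eltmE conjXg conjX // -!expgM.
apply/homgP; exists (sdprodm_morphism sdG actB).
rewrite /= -{2}defG morphim_sdprodm // !morphim_cycle ?cycle_id //= !eltm_id.
by rewrite -norm_joinEr // norms_cycle ab groupV cycle_id.
Qed.

Lemma inverted3_isog_D6 (gT : finGroupType) (G : {group gT}) u y :
    <[u]> * <[y]> = G -> #[u] = 3 -> #[y] = 2 -> u ^ y = u^-1 ->
  G \isog 'D_6.
Proof.
move=> defG ou oy uy.
have oG : #|G| = 6 by rewrite -defG coprime_cardMg -!orderE ou oy.
have q_gt1 : 1 < 3 by [].
rewrite isogEcard oG (card_dihedral q_gt1) andbT (Grp_dihedral q_gt1).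
apply/existsP; exists (u, y); rewrite /= !xpair_eqE.
rewrite norm_joinEr ?norms_cycle ?uy ?groupV ?cycle_id // defG eqxx.
by rewrite -{1}ou -oy !expg_order !eqxx.
Qed.

Lemma isog_S3 : [set: 'S_3] \isog 'D_6.
Proof.
pose i0 : 'I_3 := inord 0; pose i1 : 'I_3 := inord 1; pose i2 : 'I_3 := inord 2.
have [n01 n02 n12] : [/\ i0 != i1, i0 != i2 & i1 != i2].
  by rewrite -!val_eqE /= !inordK.
have [n10 n20 n21] : [/\ i1 != i0, i2 != i0 & i2 != i1].
  by split; rewrite eq_sym.
have ordE i : [|| i == i0, i == i1 | i == i2].
  by rewrite -!val_eqE /= !inordK //; case: i => [[|[|[|m]]]].
pose y := tperm i0 i1; pose u := tperm i0 i1 * tperm i1 i2.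
have oy : #[y] = 2.
  apply: nt_prime_order => //; first by rewrite expgS expg1 tperm2.
  by apply: contraNneq n01 => y1; rewrite -[i1](tpermL i0) -/y y1 perm1.
have u0 : u i0 = i2 by rewrite permM tpermL tpermL.
have u1 : u i1 = i0.
  by rewrite permM tpermR tpermD.
have u2 : u i2 = i1.
  by rewrite permM (@tpermD _ i0 i1 i2) ?tpermR.
have [y0 y1 y2] : [/\ y i0 = i1, y i1 = i0 & y i2 = i2].
  by rewrite tpermL tpermR tpermD.
clearbody u y.
have ou : #[u] = 3.
  apply: nt_prime_order => //; last first.
    by apply: contraNneq n02 => e1; rewrite -u0 e1 perm1.
  apply/permP=> i; rewrite !permM perm1.
  by case/or3P: (ordE i) => /eqP->; rewrite !(u0, u1, u2).
apply: (@inverted3_isog_D6 _ [set: 'S_3]%G u y) => //.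
  apply/eqP; rewrite eqEcard subsetT /= cardsT card_Sn.
  by rewrite coprime_cardMg -!orderE ?ou ?oy.
rewrite conjgE !invg_expg ou oy; apply/permP=> i; rewrite !permM.
by case/or3P: (ordE i) => /eqP->; rewrite !(u0, u1, u2, y0, y1, y2).
Qed.

(** * The classification *)

Section Assembly.

Variables (gT : finGroupType) (G P Q : {group gT}).
Hypotheses (intG : integral_sections G) (sdG : P ><| Q = G).
Hypotheses (pP : 3.-group P) (pQ : 2.-group Q).

Let sPG : P \subset G. Proof. by case/sdprod_context: sdG => /andP[]. Qed.
Let sQG : Q \subset G. Proof. by case/sdprod_context: sdG. Qed.
Let nPQ : Q \subset 'N(P). Proof. by case/sdprodP: sdG. Qed.
Let defG : P * Q = G. Proof. by case/sdprodP: sdG. Qed.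
Let intP := integral_sectionsS sPG intG.
Let intQ := integral_sectionsS sQG intG.
Let abelP : 3.-abelem P. Proof. exact: three_group_abelem. Qed.

Lemma cent_order3_expg2 u s :
  u \in G -> #[u] = 3 -> s \in Q -> commute u s -> s ^+ 2 = 1.
Proof.
move=> Gu ou Qs cus; apply: contraTeq isT => s2.
have os : #[s] = 4 by exact: (two_elt_order4 pQ intQ Qs s2).
have ous : #[u * s] = 12 by rewrite orderM // ou os.
have := totient_order intG (groupM Gu (subsetP sQG s Qs)) (dvdnn _).
by rewrite ous.
Qed.

Lemma centralised_sylow3 : P :!=: 1 -> Q \subset 'C(P) -> abelian G /\ exponent G %| 6.
Proof.
move=> ntP cPQ; have [u Pu ntu] := trivgPn _ ntP.
have ou : #[u] = 3 by apply: (abelem_order_p abelP).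
have Q2 s : s \in Q -> s ^+ 2 = 1.
  move=> Qs; apply: (cent_order3_expg2 (subsetP sPG u Pu) ou Qs).
  by apply/commute_sym/(centP (subsetP cPQ s Qs)).
have cQQ : abelian Q.
  apply/centsP=> s Qs r Qr.
  by apply: (involution_central pQ intQ Qs Qr); apply: Q2.
have cPP := abelem_abelian abelP.
split; first by rewrite -defG abelianM cPP cQQ.
apply/exponentP=> g; rewrite -defG => /imset2P[p s Pp Qs ->].
have cps : commute p s by apply/commute_sym/(centP (subsetP cPQ s Qs)).
rewrite expgMn // (expgM s 2 3) Q2 // expg1n mulg1 (expgM p 3 2).
by rewrite (three_elt_expg3 pP) // expg1n.
Qed.

(** If y in Q does not centralise P then y^2 does, for otherwise y^2 inverts
P = C3 although the automorphism group of C3 has order 2.  So P = <u>, and y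
inverts u.  An element s of Q centralising P has order at most 2, because there
is no element of order 12; if s were outside <y^2> then us would have order 6
modulo y^2 and be inverted by y, which is the dodecagon configuration.  Hence
C_Q(P) = <y^2> and Q = <y>. *)
Lemma inverted_sylow3 : P :!=: 1 -> ~~ (Q \subset 'C(P)) ->
  exists u y, [/\ <[u]> ><| <[y]> = G, #[u] = 3, u ^ y = u^-1
                & #[y] = 2 \/ #[y] = 4].
Proof.
move=> ntP /subsetPn[y Qy ncPy].
have sub g : g \in Q -> g \in G by apply: (subsetP sQG).
have nP g : g \in Q -> g \in 'N(P) by apply: (subsetP nPQ).
have Q4 g : g \in Q -> g ^+ 4 = 1 by move=> Qg; apply: (two_elt_expg4 pQ intQ).
have cPy2 : y ^+ 2 \in 'C(P).
  apply: contraT => ncPy2.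
  have [u Pu [ou uy2]] :
      exists2 u, P :=: <[u]> & #[u] = 3 /\ u ^ (y ^+ 2) = u^-1.
    apply: (abelem3_involution intG sPG abelP) => //.
    - by rewrite groupX ?sub.
    - by rewrite groupX ?nP.
    - by rewrite -expgM Q4.
  have : u ^ y \in <[u]> by rewrite -Pu memJ_norm ?nP // Pu cycle_id.
  have uV : u != u^-1.
    by rewrite eq_sym eq_invg_mul -[u * u]/(u ^+ 2) -order_dvdn ou.
  have uyy : (u ^ y) ^ y = u^-1 by rewrite -conjgM.
  case/(order3_cases ou) => uy; move: uyy uV; rewrite uy.
  - by move/eqP: uy; rewrite conjg_eq1 => /eqP u1; rewrite u1 order1 in ou.
  - by rewrite uy => <-; rewrite eqxx.
  by rewrite conjVg uy invgK => <-; rewrite eqxx.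
have [u Pu [ou uy]] : exists2 u, P :=: <[u]> & #[u] = 3 /\ u ^ y = u^-1.
  by apply: (abelem3_two_elt intG sPG abelP); auto.
have Gu : u \in G by rewrite (subsetP sPG) // Pu cycle_id.
have Pu' : u \in P by rewrite Pu cycle_id.
have cPE g : (g \in 'C(P)) = (u ^ g == u).
  rewrite Pu cent_cycle; apply/cent1P/eqP=> [cgu | /conjg_fixP/commgP/commute_sym //].
  by apply/conjg_fixP/commgP/commute_sym.
have C2 s : s \in Q -> s \in 'C(P) -> s ^+ 2 = 1.
  move=> Qs cs; apply: (cent_order3_expg2 Gu ou Qs).
  exact/commute_sym/(centP cs).
have y22 : (y ^+ 2) ^+ 2 = 1 by apply: C2 => //; apply: groupX.
have Cy2 s : s \in Q -> s \in 'C(P) -> s \in <[y ^+ 2]>.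
  move=> Qs cs; apply: contraT => nsy.
  pose N := <[y ^+ 2]>%G.
  have nNG : N <| G.
    rewrite /normal cycle_subG groupX ?sub //= cents_norm // cent_cycle -defG.
    rewrite mul_subG // sub_cent1 //.
    apply/centP=> g Qg; apply: (involution_central pQ intQ) => //.
    by rewrite groupX.
  have intGN := integral_sections_quotient nNG intG.
  have nNg g : g \in G -> g \in 'N(N) by apply/subsetP/normal_norm.
  have s2 := C2 s Qs cs; have [Gs Gy] := (sub s Qs, sub y Qy).
  have csy : commute s y by apply: (involution_central pQ intQ).
  have csu : commute s u by apply: (centP cs).
  have [nu ns ny] : [/\ u \in 'N(N), s \in 'N(N) & y \in 'N(N)].
    by split; apply: nNg.
  have oub : #[coset N u] = 3.
    apply: nt_prime_order => //; first by rewrite -morphX // -ou expg_order morph1.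
    apply/eqP=> /(coset_idr nu) Nu.
    have : #[u] %| 2.
      by apply: dvdn_trans (order_dvdG Nu) _; rewrite -orderE order_dvdn y22.
    by rewrite ou.
  have osb : #[coset N s] = 2.
    apply: nt_prime_order => //; first by rewrite -morphX // s2 morph1.
    by apply: contraNneq nsy => /(coset_idr ns).
  have cosetJ g h : g \in 'N(N) -> h \in 'N(N) -> coset N g ^ coset N h = coset N (g ^ h).
    by move=> Ng Nh; rewrite morphJ.
  have cb : commute (coset N u) (coset N s).
    by rewrite /commute -!morphM // csu.
  case: (@no_dihedral _ (G / N) intGN 6 (coset N u * coset N s) (coset N y)) => //.
  - by rewrite groupM ?mem_quotient.
  - by rewrite mem_quotient.
  - by rewrite orderM // oub osb.
  - by rewrite -morphX //; apply/coset_id/cycle_id.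
  rewrite conjMg !cosetJ // uy.
  have -> : s ^ y = s by apply/conjg_fixP/commgP.
  have sV : (coset N s)^-1 = coset N s by rewrite invg_expg osb.
  by rewrite invMg sV morphV // (commuteV (commute_sym cb)).
have defQ : Q :=: <[y]>.
  apply/eqP; rewrite eqEsubset cycle_subG Qy andbT; apply/subsetP=> s Qs.
  have y2y : y ^+ 2 \in <[y]> by apply: mem_cycle.
  have sub2 : <[y ^+ 2]> \subset <[y]> by rewrite cycle_subG.
  have [cs | ncs] := boolP (s \in 'C(P)); first exact/(subsetP sub2)/Cy2.
  have us : u ^ s = u^-1.
    have : u ^ s \in <[u]> by rewrite -Pu memJ_norm ?nP // Pu cycle_id.
    case/(order3_cases ou) => // [/eqP|us].
      by rewrite conjg_eq1 => /eqP u1; rewrite u1 order1 in ou.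
    by rewrite cPE us eqxx in ncs.
  have : y^-1 * s \in <[y ^+ 2]>.
    apply: (Cy2); first by rewrite groupM ?groupV.
    rewrite cPE conjgM.
    have -> : u ^ y^-1 = u^-1 by apply: (canLR (conjgK y)); rewrite conjVg uy invgK.
    by rewrite conjVg us invgK.
  by move/(subsetP sub2); rewrite groupMl ?groupV ?cycle_id.
exists u, y; split=> //; first by rewrite -Pu -defQ.
have : #[y] %| 4 by rewrite order_dvdn Q4.
have : #[y] != 1%N.
  by rewrite order_eq1; apply: contraNneq ncPy => ->; apply: group1.
have : #[y] <= 4 by rewrite dvdn_leq // order_dvdn Q4.
by case: #[y] => [|[|[|[|[|n]]]]] //; [left | right].
Qed.

End Assembly.

Theorem theorem1p3 (gT : finGroupType) (hG : desirable_group gT) :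
  (abelian [set: gT] /\
     ((exponent [set: gT] %| 4)%N \/ (exponent [set: gT] %| 6)%N))
  \/ (exists m : nat, [set: gT] \isog [set: 'Q_8 * 'rV['Z_2]_m])
  \/ [set: gT] \isog [set: 'S_3]
  \/ [set: gT] \isog [set: 'S_3 * 'Z_2]
  \/ [set: gT] \isog
       Grp (x : y : x ^+ 3 = y ^+ 4 = 1, y^-1 * x * y = x^-1).
Proof.
have intG := desirable_integral_sections hG.
have [P [Q [sdG pP pQ]]] := integral_sdprod intG.
have [P1 | ntP] := eqsVneq P 1.
  have pG : 2.-group [set: gT] by move: sdG; rewrite P1 sdprod1g => <-.
  have G4 g : g \in [set: gT] -> g ^+ 4 = 1 by apply: two_elt_expg4.
  have [abG | nabG] := boolP (abelian [set: gT]).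
    by left; split=> //; left; apply/exponentP.
  right; left; have [x [y nxy]] : exists x y : gT, ~ commute x y.
    have /subsetPn[x _ ncx] := nabG.
    have /forallPn[y /eqP nxy] : ~~ [forall y, x * y == y * x].
      apply: contra ncx => /forallP cx; apply/centP=> y _; exact/eqP.
    by exists x, y.
  exact: (two_group_isog pG intG (in_setT x) (in_setT y) nxy).
have [cPQ | ncPQ] := boolP (Q \subset 'C(P)).
  by left; have [] := centralised_sylow3 intG sdG pP pQ ntP cPQ; split=> //; right.
have [u [y [sduy ou uy [oy | oy]]]] := inverted_sylow3 intG sdG pP pQ ntP ncPQ.
  right; right; left; apply: isog_trans (isog_symr isog_S3).
  have /sdprodP[_ defG _ _] := sduy; exact: inverted3_isog_D6 defG ou oy uy.
right; right; right; right; exact: dicyclic12_isog sduy ou oy uy.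
Qed.
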